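(* Let $f(x,y)$ be a $(p,q)$-invariant complex polynomial defining an algebraic link $K$ in $L_{p,q}$ whose lift is $\widetilde{K}=f^{-1}(0)\cap S^3_\epsilon$. Let $0<\epsilon\le\epsilon_0$ and consider $\{\epsilon\}\times L_{p,q}$ as the quotient of $S^3_\epsilon$ under the action $\zeta\cdot(x,y)=(\zeta x,\zeta^q y)$. For any $t\in[0,2\pi)$, the inverse image $F_t=\Psi^{-1}(e^{it})\subset(\{\epsilon\}\times L_{p,q})\setminus K$ is a smooth surface.
   Context: Let $p\ge 1$ and $q$ be coprime integers and let $\zeta\in\mathbb{C}$ be a primitive $p$-th root of unity. Write $S^3_\epsilon=\{(x,y)\in\mathbb{C}^2 : |x|^2+|y|^2=\epsilon^2\}$. The cyclic group $G_{p,q}=\langle\zeta\rangle\cong\mathbb{Z}_p$ acts freely on $S^3_\epsilon$ by $\zeta\cdot(x,y)=(\zeta x,\zeta^q y)$. The lens space is $L_{p,q}=S^3_\epsilon/G_{p,q}$, also written $\{\epsilon\}\times L_{p,q}$, with quotient map $\pi\colon S^3_\epsilon\to L_{p,q}$ and the smooth structure making $\pi$ a smooth covering. The lift of a link in $L_{p,q}$ is its preimage under $\pi$. A polynomial $f(x,y)$ is $(p,q)$-invariant if there is an integer $0\le k<p$ with $f(\zeta x,\zeta^q y)=\zeta^k f(x,y)$ for all $(x,y)\in\mathbb{C}^2$. Polynomials are assumed non-constant, with $f(0,0)=0$, and either irreducible or a product of distinct irreducible polynomials. For the given $f$ the links are $\widetilde{K}=f^{-1}(0)\cap S^3_\epsilon$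 and $K=\pi(\widetilde{K})$. Set $\overline{p}=p/\gcd(k,p)$ (with $\gcd(0,p)=p$). Let $\Phi\colon S^3_\epsilon\setminus\widetilde{K}\to S^1$, $\Phi(x,y)=f(x,y)/|f(x,y)|$, and $\mu(z)=z^{\overline{p}}$ on $S^1$. The map $\Psi\colon (\{\epsilon\}\times L_{p,q})\setminus K\to S^1$ is the well-defined map with $\Psi\circ\pi=\mu\circ\Phi$. The number $\epsilon_0>0$ (depending on $f$) is one provided by Milnor's theorem: for all $0<\epsilon\le\epsilon_0$ the map $\Phi$ has no critical points. *)

(* Defs.v *)
From HB Require Import structures.
From mathcomp Require Import all_boot all_order all_algebra generic_quotient.
From mathcomp Require Import complex.
From mathcomp Require Import all_classical all_reals all_analysis.

Set Implicit Arguments.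
Unset Strict Implicit.
Unset Printing Implicit Defensive.

Import Order.TTheory GRing.Theory Num.Theory.
Import numFieldNormedType.Exports.

Local Open Scope classical_set_scope.
Local Open Scope ring_scope.
Local Open Scope complex_scope.
Local Open Scope quotient_scope.

Section smoothness.
Context {R : realType}.

(* [U] is meant to be open and [V] finite-dimensional; then this is the usual
   C^k: all iterated directional derivatives up to order k exist and are
   continuous on U. *)
Fixpoint Ck (V W : normedModType R) (k : nat) (U : set V) (g : V -> W) : Prop :=
  {in U, continuous g} /\
  if k is j.+1 then
    forall v : V, {in U, forall x, derivable g x v} /\ Ck j U (fun x => 'D_v g x)
  else True.

Definition smooth (V W : normedModType R) (U : set V) (g : V -> W) : Prop :=
  forall k, Ck k U g.

(* Velocities at x of smooth curves in X. *)
Definition tangent_space (n : nat) (X : set 'rV[R]_n) (x : 'rV[R]_n) :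
    set 'rV[R]_n :=
  [set v | exists (I : set R) (c : R -> 'rV[R]_n),
    [/\ open_nbhs 0 I, smooth I c, c @` I `<=` X, c 0 = x & derive1 c 0 = v]].

(* h is a map X -> Y given by a formula that is smooth on a neighbourhood of X
   in the ambient space, so its differential on the tangent space of X is the
   restriction of the ambient one. *)
Definition critical_point (m n : nat) (X : set 'rV[R]_m) (Y : set 'rV[R]_n)
    (h : 'rV[R]_m -> 'rV[R]_n) (x : 'rV[R]_m) : Prop :=
  X x /\
  ~ (tangent_space Y (h x) `<=` [set 'D_v h x | v in tangent_space X x]).

(* Smoothness of a map defined on a subset X of R^N, near a point of X: it
   extends locally to a smooth map of the ambient space. *)
Definition smooth_at (N n : nat) (X : set 'rV[R]_N) (g : X -> 'rV[R]_n)
    (x : X) : Prop :=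
  exists (W : set 'rV[R]_N) (G : 'rV[R]_N -> 'rV[R]_n),
    [/\ open_nbhs (set_val x) W, smooth W G &
        forall y : X, W (set_val y) -> g y = G (set_val y)].

Definition local_diffeo_at (N n : nat) (X : set 'rV[R]_N) (g : X -> 'rV[R]_n)
    (x : X) : Prop :=
  exists (A : set X) (s : 'rV[R]_n -> X),
    [/\ open_nbhs x A, forall y, A y -> smooth_at g y, open (g @` A),
        smooth (g @` A) (fun u => set_val (s u)) &
        forall y, A y -> s (g y) = y].

End smoothness.

Section charts.
Context {R : realType} {M : topologicalType} {n : nat}.

Record chart := Chart { dom : set M ; coords : M -> 'rV[R]_n }.

(* coords is a homeomorphism from the open set dom onto an open set of R^n. *)
Definition is_chart (c : chart) : Prop :=
  [/\ open (dom c), set_inj (dom c) (coords c), {in dom c, continuous (coords c)} &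
      forall A, open A -> A `<=` dom c -> open (coords c @` A)].

Definition atlas_on (A : set chart) (O : set M) : set chart :=
  [set c | A c /\ dom c `<=` O].

Definition slice (k : nat) : set 'rV[R]_n :=
  [set v | forall i : 'I_n, (k <= i)%N -> v 0 i = 0].

(* Embedded k-dimensional submanifold, by slice charts. *)
Definition smooth_submanifold (A : set chart) (k : nat) (F : set M) : Prop :=
  forall x, F x -> exists c : chart,
    [/\ A c, dom c x &
        coords c @` (dom c `&` F) = (coords c @` dom c) `&` slice k].

End charts.
Arguments chart : clear implicits.

Section polynomials.

Definition irreducible_elt (A : idomainType) (a : A) : Prop :=
  [/\ a != 0, a \isn't a GRing.unit &
      forall b c : A, a = b * c -> b \is a GRing.unit \/ c \is a GRing.unit].

Context {R : realType}.

(* C[x,y] is {poly {poly C}}, the outer variable being x. *)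
Definition eval2 (f : {poly {poly R[i]}}) (x y : R[i]) : R[i] := f.[x%:P].[y].

Definition admissible (f : {poly {poly R[i]}}) : Prop :=
  [/\ forall c : R[i], f <> c%:P%:P,
      eval2 f 0 0 = 0 &
      exists s : seq {poly {poly R[i]}},
        [/\ uniq s, {in s, forall g, irreducible_elt g} & f = \prod_(g <- s) g]].

Definition invariant_with (zeta : R[i]) (q : int) (k : nat)
    (f : {poly {poly R[i]}}) : Prop :=
  forall x y : R[i], eval2 f (zeta * x) (zeta ^ q * y) = zeta ^+ k * eval2 f x y.

End polynomials.

Section lens_space.
Context {R : realType}.

(* R^4 is identified with C^2 by (Re x, Im x, Re y, Im y). *)
Definition cx (v : 'rV[R]_4) : R[i] := v 0 (inord 0) +i* v 0 (inord 1).
Definition cy (v : 'rV[R]_4) : R[i] := v 0 (inord 2) +i* v 0 (inord 3).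

Definition realify (z : R[i]) : 'rV[R]_2 :=
  \row_(j < 2) if j == 0 then complex.Re z else complex.Im z.

Definition circle : set 'rV[R]_2 := [set realify z | z in [set z : R[i] | `|z| = 1]].

Definition sphere3 (eps : R) : set 'rV[R]_4 :=
  [set v | `|cx v| ^+ 2 + `|cy v| ^+ 2 = (eps ^+ 2)%:C].

(* Orbit under the group generated by zeta, with g.(x,y) = (g x, g^q y). *)
Definition orbit_of (zeta : R[i]) (q : int) (eps : R) (v : sphere3 eps) :
    set (sphere3 eps) :=
  [set w | exists n : nat,
     cx (set_val w) = zeta ^+ n * cx (set_val v) /\
     cy (set_val w) = (zeta ^+ n) ^ q * cy (set_val v)].

Definition same_orbit (zeta : R[i]) (q : int) (eps : R) : rel (sphere3 eps) :=
  fun v w => `[< orbit_of zeta q v = orbit_of zeta q w >].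

Lemma same_orbit_refl zeta q eps : reflexive (@same_orbit zeta q eps).
Proof. by move=> v; apply/asboolP. Qed.

Lemma same_orbit_sym zeta q eps : symmetric (@same_orbit zeta q eps).
Proof. by move=> v w; apply/asboolP/asboolP => ->. Qed.

Lemma same_orbit_trans zeta q eps : transitive (@same_orbit zeta q eps).
Proof. by move=> v u w /asboolP uv /asboolP vw; apply/asboolP; rewrite uv. Qed.

Canonical same_orbit_equiv zeta q eps :=
  EquivRel (@same_orbit zeta q eps) (@same_orbit_refl zeta q eps)
    (@same_orbit_sym zeta q eps) (@same_orbit_trans zeta q eps).

Definition lens (zeta : R[i]) (q : int) (eps : R) : Type :=
  quotient_topology {eq_quot (same_orbit_equiv zeta q eps)}.

HB.instance Definition _ zeta q eps := Topological.copy (lens zeta q eps)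
  (quotient_topology {eq_quot (same_orbit_equiv zeta q eps)}).

Definition lens_proj (zeta : R[i]) (q : int) (eps : R) (v : sphere3 eps) :
    lens zeta q eps :=
  \pi_{eq_quot (same_orbit_equiv zeta q eps)} v.

Definition lens_repr (zeta : R[i]) (q : int) (eps : R) (l : lens zeta q eps) :
    sphere3 eps :=
  repr (l : {eq_quot (same_orbit_equiv zeta q eps)}).

(* The maximal atlas for which the projection from the sphere is a local
   diffeomorphism. *)
Definition lens_atlas (zeta : R[i]) (q : int) (eps : R) :
    set (chart R (lens zeta q eps) 3) :=
  [set c | is_chart c /\
     forall v : sphere3 eps, dom c (lens_proj zeta q v) ->
       local_diffeo_at (fun w => coords c (lens_proj zeta q w)) v].

End lens_space.

Section milnor_map.
Context {R : realType}.
Implicit Types (f : {poly {poly R[i]}}) (zeta : R[i]).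

Definition evalR4 f (v : 'rV[R]_4) : R[i] := eval2 f (cx v) (cy v).

Definition link_lift f (eps : R) : set (sphere3 eps) :=
  [set v | evalR4 f (set_val v) = 0].
Arguments link_lift : clear implicits.

Definition link f zeta (q : int) (eps : R) : set (lens zeta q eps) :=
  [set lens_proj zeta q v | v in link_lift f eps].
Arguments link : clear implicits.

Definition Phi f (v : 'rV[R]_4) : R[i] := evalR4 f v / `|evalR4 f v|.

Definition Phi_no_critical_point f (eps : R) : Prop :=
  forall v, ~ critical_point (sphere3 eps `\` [set w | evalR4 f w = 0]) circle
                (fun w => realify (Phi f w)) v.

Definition milnor_radius f (eps0 : R) : Prop :=
  0 < eps0 /\ forall eps, 0 < eps <= eps0 -> Phi_no_critical_point f eps.

Definition pbar (p k : nat) : nat := p %/ gcdn k p.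

(* Only meaningful off the link; see PsiE for independence of the
   representative. *)
Definition Psi (p k : nat) f zeta (q : int) (eps : R) (l : lens zeta q eps) :
    R[i] :=
  Phi f (set_val (lens_repr l)) ^+ pbar p k.

Definition fibre (p k : nat) f zeta (q : int) (eps t : R) :
    set (lens zeta q eps) :=
  ~` link f zeta q eps `&` [set l | Psi p k f l = cos t +i* sin t].

Lemma PsiE (p k : nat) f zeta (q : int) (eps : R) (v : sphere3 eps) :
  p.-primitive_root zeta -> invariant_with zeta q k f ->
  Psi p k f (lens_proj zeta q v) = Phi f (set_val v) ^+ pbar p k.
Proof.
move=> prz inv; rewrite /Psi.
set w := lens_repr _.
have /asboolP wv : same_orbit zeta q w v.
  by apply/eqmodP; exact: (reprK (\pi_{eq_quot (same_orbit_equiv zeta q eps)} v)).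
have : orbit_of zeta q v w.
  by rewrite -wv; exists 0%N; rewrite expr0 exp1rz !mul1r.
case=> n [ex ey].
have invn m x y : eval2 f (zeta ^+ m * x) ((zeta ^+ m) ^ q * y) =
    (zeta ^+ m) ^+ k * eval2 f x y.
  elim: m x y => [|m IH] x y; first by rewrite expr0 exp1rz expr1n !mul1r.
  by rewrite !exprS expfzMl -!mulrA inv IH mulrA -exprMn.
have p_gt0 := prim_order_gt0 prz.
have z1 : `|zeta| = 1.
  by apply/eqP; rewrite -(@pexpr_eq1 _ _ p)// -normrX (prim_expr_order prz) normr1.
rewrite /Phi /evalR4 ex ey invn normrM !normrX z1 !expr1n mul1r -mulrA exprMn.
suff -> : ((zeta ^+ n) ^+ k) ^+ pbar p k = 1 by rewrite mul1r.
have kp : (k * pbar p k = p * (k %/ gcdn k p))%N.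
  by rewrite /pbar muln_divCA_gcd.
by rewrite -exprM kp -exprM mulnCA exprM (prim_expr_order prz) expr1n.
Qed.

End milnor_map.
Arguments link {R} f zeta q eps _.
Arguments link_lift {R} f eps _.
Arguments fibre {R} p k f zeta q eps t _.
Arguments lens_atlas {R} zeta q eps _.

(* Main.v *)
(** Fix a point [v] of the sphere with [f v <> 0]. Since [Phi] has no critical
point at [v], some tangent vector of the sphere moves [Phi] along the circle, so
the polynomial function [x |-> Im (conj (f v) * f x)] has nonzero differential on
the tangent space of the sphere at [v]. Completing it, together with
[x |-> |x|^2], by two linear forms gives, by the inverse function theorem, a
chart of the sphere near [v] whose last coordinate is that function. As [Phi^m]
separates points of the circle close to [Phi v], its zero set is near [v] the
fibre of [Phi^m] through [v]. The cyclic action is free and linear, hence on a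
small neighbourhood of [v] the chart descends to the lens space, where it is a
slice chart for the fibre of [Psi]. *)
From HB Require Import structures.
Require Import Defs.
From mathcomp Require Import all_boot all_order all_algebra.
From mathcomp Require Import complex ring lra.
From mathcomp Require Import all_classical all_reals all_analysis.

Import Order.TTheory GRing.Theory Num.Theory.
Import numFieldNormedType.Exports.

Local Open Scope classical_set_scope.
Local Open Scope ring_scope.
Local Open Scope complex_scope.

Set Implicit Arguments.
Unset Strict Implicit.
Unset Printing Implicit Defensive.

(** The natural transverse coordinate would be an argument of [f], which needs a branch and a smooth
    modulus. [crossc (evalR4 f v) (evalR4 f x)] avoids both: it is polynomial in the real
    coordinates, hence smooth to all orders, and [Phi] with its square root is differentiated only
    once. The price is that its zero set also contains points where [f] is a negative multiple of
    [f v], and that [Phi ^+ m] takes equal values at distinct points of the circle; both ambiguities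
    disappear close to [v]. A second obstacle is the atlas: the chart must be compatible with the
    projection at every point of the sphere above its domain, not only at those near [v]. Since
    these points are translates of points near [v], the inverse powers of the action transport the
    coordinates to them. *)

Section differentiability.
Context {R : realType}.

(** The differential is prescribed beforehand, and [diff_unique] identifies it with ['d f x]. This
    form suits the inverse function, whose differential is guessed as an inverse Jacobian and then
    checked by an estimate. *)
Lemma is_diff_epsP (V W : normedModType R) (f : V -> W) (df : {linear V -> W})
    (x : V) : continuous df ->
  (forall e, 0 < e -> \forall y \near x, `|f y - f x - df (y - x)| <= e * `|y - x|) ->
  is_diff x f df.
Proof.
move=> cdf fx.
have fo : f \o shift x = cst (f x) + df +o_ 0 id.
  apply/eqaddoP => e e0.
  have := fx e e0; rewrite (near_shift 0) /=.
  by apply: filterS => y /=; rewrite subr0 !fctE /= addrK opprD addrA.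
have dE := diff_unique cdf fo.
by apply: DiffDef => //; apply/diff_locallyP; rewrite dE.
Qed.

Lemma differentiable_epsP (V W : normedModType R) (f : V -> W) (x : V) :
  differentiable f x ->
  forall e, 0 < e -> \forall y \near x, `|f y - f x - 'd f x (y - x)| <= e * `|y - x|.
Proof.
move=> /diff_locally/eqaddoP fo e e0; rewrite (near_shift 0) /=.
have := fo e e0; apply: filterS => y /=.
by rewrite subr0 !fctE /= addrK opprD addrA.
Qed.

Lemma near_eq_differentiable (V W : normedModType R) (f g : V -> W) (x : V) :
  {near x, f =1 g} -> differentiable f x -> differentiable g x.
Proof.
move=> fg df.
have fgx := nbhs_singleton fg.
suff : is_diff x g ('d f x) by case.
apply: is_diff_epsP; first exact: diff_continuous.
move=> e e0; have := differentiable_epsP df e0.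
by move: fg; apply: filterS2 => y fgy; rewrite fgy fgx.
Qed.

Lemma differentiable_row (V : normedModType R) n (G : V -> 'rV[R]_n) (x : V) :
  (forall j, differentiable (fun y => G y 0 j) x) -> differentiable G x.
Proof.
move=> dG.
rewrite (_ : G = \sum_j (fun y => G y 0 j *: delta_mx 0 j)).
  by apply: differentiable_sum => j; exact: differentiableZl.
by apply/funext => y; rewrite fct_sumE [LHS]row_sum_delta.
Qed.

End differentiability.

(** * Calculus of functions that are Frechet differentiable to a given order *)

Section strong_smoothness.
Context {R : realType}.
Implicit Types V : normedModType R.

(* The inductive class in which the calculus is done: unlike [Ck], it carries
   Frechet differentiability at each stage, so the chain rule is available. *)
Fixpoint Dk V (k : nat) (U : set V) (g : V -> R) : Prop :=
  (forall x, U x -> differentiable g x) /\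
  if k is j.+1 then forall v, Dk j U (fun x => 'D_v g x) else True.

Lemma Dk_differentiable V k (U : set V) g x :
  Dk k U g -> U x -> differentiable g x.
Proof. by case: k => [|k] [+ _]; apply. Qed.

Lemma Dk_derive V k (U : set V) g v :
  Dk k.+1 U g -> Dk k U (fun x => 'D_v g x).
Proof. by case=> _; apply. Qed.

Lemma DkW V k (U : set V) g : Dk k.+1 U g -> Dk k U g.
Proof.
elim: k g => [|k IH] g [dg dk]; split => // v; exact/IH/dk.
Qed.

Lemma subset_Dk V k (U U' : set V) g : U' `<=` U -> Dk k U g -> Dk k U' g.
Proof.
move=> sU; elim: k g => [|k IH] g [dg dk]; split => //.
- by move=> x /sU; exact: dg.
- by move=> x /sU; exact: dg.
- by move=> v; exact/IH/dk.
Qed.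

(** Openness turns equality on [U] into equality near each of its points, so the derivatives agree
    on [U] too and the induction continues. *)
Lemma eq_Dk V k (U : set V) g h : open U -> (forall x, U x -> g x = h x) ->
  Dk k U g -> Dk k U h.
Proof.
move=> oU; elim: k g h => [|k IH] g h gh [dg dk]; split => //.
- move=> x Ux; apply: near_eq_differentiable (dg x Ux).
  by apply: filterS gh _; exact: open_nbhs_nbhs.
- move=> x Ux; apply: near_eq_differentiable (dg x Ux).
  by apply: filterS gh _; exact: open_nbhs_nbhs.
- move=> v; apply: IH (dk v) => x Ux; apply: near_eq_derive.
  by apply: filterS gh _; exact: open_nbhs_nbhs.
Qed.

Lemma Dk_cst V k (U : set V) (a : R) : Dk k U (cst a).
Proof.
elim: k a => [|k IH] a; split => //; try by move=> *; exact: differentiable_cst.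
move=> v; rewrite (_ : (fun _ => _) = cst 0) //.
by apply/funext => x; rewrite derive_cst.
Qed.

Lemma Dk_linear V k (U : set V) (l : {linear V -> R}) : continuous l -> Dk k U l.
Proof.
move=> cl; have dl x : differentiable l x by exact: linear_differentiable.
case: k => [|k]; split => // v.
rewrite (_ : (fun _ => _) = cst (l v)); first exact: Dk_cst.
by apply/funext => x; rewrite deriveE// diff_lin.
Qed.

Lemma DkD V k (U : set V) f g : open U -> Dk k U f -> Dk k U g ->
  Dk k U (fun x => f x + g x).
Proof.
move=> oU; elim: k f g => [|k IH] f g [df dkf] [dg dkg]; split => //.
- by move=> x Ux; apply: differentiableD; [exact: df|exact: dg].
- by move=> x Ux; apply: differentiableD; [exact: df|exact: dg].
- move=> v; apply: (eq_Dk oU _ (IH _ _ (dkf v) (dkg v))) => x Ux.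
  by rewrite deriveD //; apply: diff_derivable; [exact: df|exact: dg].
Qed.

Lemma DkM V k (U : set V) f g : open U -> Dk k U f -> Dk k U g ->
  Dk k U (fun x => f x * g x).
Proof.
move=> oU; elim: k f g => [|k IH] f g Df Dg; have [df dkf] := Df;
    have [dg dkg] := Dg; split => //.
- by move=> x Ux; apply: differentiableM; [exact: df|exact: dg].
- by move=> x Ux; apply: differentiableM; [exact: df|exact: dg].
- move=> v; apply: (eq_Dk oU _ (DkD oU (IH _ _ (DkW Df) (dkg v))
    (IH _ _ (DkW Dg) (dkf v)))) => x Ux.
  by rewrite deriveM //; apply: diff_derivable; [exact: df|exact: dg].
Qed.

Lemma DkZ V k (U : set V) (a : R) f : open U -> Dk k U f ->
  Dk k U (fun x => a * f x).
Proof. by move=> oU; apply: (DkM oU); exact: Dk_cst. Qed.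

Lemma DkN V k (U : set V) f : open U -> Dk k U f -> Dk k U (fun x => - f x).
Proof.
move=> oU /(DkZ (-1) oU); rewrite (_ : (fun _ => -1 * _) = (fun x => - f x))//.
by apply/funext => x; rewrite mulN1r.
Qed.

Lemma DkB V k (U : set V) f g : open U -> Dk k U f -> Dk k U g ->
  Dk k U (fun x => f x - g x).
Proof. by move=> oU Df Dg; apply: DkD => //; exact: DkN. Qed.

Lemma Dk_sum V k (U : set V) (I : Type) (r : seq I) (P : pred I)
    (f : I -> V -> R) : open U ->
  (forall i, Dk k U (f i)) -> Dk k U (fun x => \sum_(i <- r | P i) f i x).
Proof.
move=> oU Df; elim: r => [|i r IH].
  by rewrite (_ : (fun _ => _) = cst 0); [exact: Dk_cst|by apply/funext => x; rewrite big_nil].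
have [Pi|Pi] := boolP (P i); last first.
  by apply: eq_Dk IH => // x _; rewrite big_cons (negPf Pi).
by apply: eq_Dk (DkD oU (Df i) IH) => // x _; rewrite big_cons Pi.
Qed.

Lemma Dk_prod V k (U : set V) (I : Type) (r : seq I) (P : pred I)
    (f : I -> V -> R) : open U ->
  (forall i, Dk k U (f i)) -> Dk k U (fun x => \prod_(i <- r | P i) f i x).
Proof.
move=> oU Df; elim: r => [|i r IH].
  by rewrite (_ : (fun _ => _) = cst 1); [exact: Dk_cst|by apply/funext => x; rewrite big_nil].
have [Pi|Pi] := boolP (P i); last first.
  by apply: eq_Dk IH => // x _; rewrite big_cons (negPf Pi).
by apply: eq_Dk (DkM oU (Df i) IH) => // x _; rewrite big_cons Pi.
Qed.

Lemma DkV V k (U : set V) f : open U -> (forall x, U x -> f x != 0) ->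
  Dk k U f -> Dk k U (fun x => (f x)^-1).
Proof.
move=> oU f0; elim: k => [|k IH] Df; have [df dkf] := Df; split => //.
- by move=> x Ux; apply: differentiableV; [exact: df|exact: f0].
- by move=> x Ux; apply: differentiableV; [exact: df|exact: f0].
- move=> v; have Dfk := IH (DkW Df).
  apply: (eq_Dk oU _ (DkN oU (DkM oU (DkM oU Dfk Dfk) (dkf v)))) => x Ux.
  rewrite deriveV ?f0//; last exact/diff_derivable/df.
  by rewrite -mulNr -invfM -expr2.
Qed.

Definition Drow V n (k : nat) (U : set V) (G : V -> 'rV[R]_n) :=
  forall j, Dk k U (fun x => G x 0 j).

Lemma Drow_differentiable V n k (U : set V) (G : V -> 'rV[R]_n) x :
  Drow k U G -> U x -> differentiable G x.
Proof.
by move=> DG Ux; apply: differentiable_row => j; exact: Dk_differentiable Ux.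
Qed.

Lemma derive_row V n (G : V -> 'rV[R]_n) x v j : derivable G x v ->
  'D_v G x 0 j = 'D_v (fun y => G y 0 j) x.
Proof. by move=> dG; rewrite derive_mx// mxE. Qed.

(** By the chain rule the derivative is a sum of products of a partial derivative of [G] and a
    partial derivative of [g] composed with [G]. The latter is again a composition, with an outer
    function of lower order, so the induction hypothesis covers it. *)
Lemma Dk_comp V n k (U : set V) (O : set 'rV[R]_n) (G : V -> 'rV[R]_n)
    (g : 'rV[R]_n -> R) : open U -> (forall x, U x -> O (G x)) ->
  Drow k U G -> Dk k O g -> Dk k U (fun x => g (G x)).
Proof.
move=> oU GO; elim: k g => [|k IH] g DG Dg.
  split => // x Ux; apply: differentiable_comp; first exact: Drow_differentiable Ux.
  exact/(Dk_differentiable Dg)/GO.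
split => [x Ux|v].
  apply: differentiable_comp; first exact: Drow_differentiable Ux.
  exact/(Dk_differentiable Dg)/GO.
have DGk : Drow k U G by move=> j; exact/DkW/DG.
apply: (eq_Dk (g := fun x => \sum_j
    'D_v (fun y => G y 0 j) x * 'D_(delta_mx 0 j) g (G x))) => //.
  move=> x Ux.
  have dG := Drow_differentiable DG Ux.
  have dg := Dk_differentiable Dg (GO _ Ux).
  rewrite [RHS]deriveE; last exact: (differentiable_comp dG dg).
  rewrite (diff_comp dG dg) /= -(deriveE v dG) ['D_v G x]row_sum_delta linear_sum.
  apply: eq_bigr => j _; rewrite linearZ/= -deriveE// derive_row//.
  exact: diff_derivable.
apply: Dk_sum => // j; apply: (DkM oU); first exact/Dk_derive/DG.
exact: (IH _ DGk (Dk_derive _ Dg)).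
Qed.

Lemma Drow_comp V m n k (U : set V) (O : set 'rV[R]_m) (G : V -> 'rV[R]_m)
    (F : 'rV[R]_m -> 'rV[R]_n) : open U -> (forall x, U x -> O (G x)) ->
  Drow k U G -> Drow k O F -> Drow k U (fun x => F (G x)).
Proof. by move=> oU GO DG DF j; exact: (Dk_comp oU GO DG (DF j)). Qed.

Lemma Dk_coord n k (U : set 'rV[R]_n) j : Dk k U (fun x => x 0 j).
Proof.
(* [have @] keeps the body of [l] transparent, so that the coordinate function is convertible to
   it. *)
have @l : {linear 'rV[R]_n -> R}.
  by exists (fun N : 'rV[R]_n => N 0 j); do 2![eexists]; do ?[constructor];
     rewrite ?mxE// => ? *; rewrite ?mxE//; move=> ?; rewrite !mxE.
by rewrite (_ : (fun _ => _) = l)//; apply: Dk_linear; exact: coord_continuous.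
Qed.

Lemma Drow_mulmx m n k (U : set 'rV[R]_m) (M : 'M[R]_(m, n)) : open U ->
  Drow k U (fun x => x *m M).
Proof.
move=> oU j; under eq_fun do rewrite mxE.
by apply: Dk_sum => // i; apply: DkM => //; [exact: Dk_coord|exact: Dk_cst].
Qed.

Lemma Dk_det V n k (U : set V) (M : V -> 'M[R]_n) : open U ->
  (forall i j, Dk k U (fun x => M x i j)) -> Dk k U (fun x => \det (M x)).
Proof.
move=> oU DM; rewrite /determinant; apply: Dk_sum => // s.
by apply: DkZ => //; exact: Dk_prod.
Qed.

(** Cramer's rule: the entries of the inverse are cofactors divided by the determinant. *)
Lemma Dk_invmx V n k (U : set V) (M : V -> 'M[R]_n) : open U ->
  (forall x, U x -> M x \in unitmx) ->
  (forall i j, Dk k U (fun x => M x i j)) ->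
  forall i j, Dk k U (fun x => invmx (M x) i j).
Proof.
move=> oU uM DM i j.
apply: (eq_Dk (g := fun x => (\det (M x))^-1 * cofactor (M x) j i)) => //.
  by move=> x Ux; rewrite /invmx uM// !mxE.
apply: DkM => //.
  by apply: DkV => //; [move=> x /uM; rewrite unitmxE unitfE|exact: Dk_det].
apply: DkZ => //; apply: Dk_det => // a b.
by under eq_fun do rewrite !mxE; exact: DM.
Qed.

(** The bridge back to the notion of smoothness of the statement: Frechet differentiability supplies
    both the continuity and the directional derivatives that [Ck] requires. *)
Lemma Drow_Ck V n k (U : set V) (G : V -> 'rV[R]_n) : open U ->
  Drow k U G -> Ck k U G.
Proof.
move=> oU; elim: k G => [|k IH] G DG; split => //.
- move=> x /set_mem Ux; apply: differentiable_continuous.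
  exact: Drow_differentiable Ux.
- move=> x /set_mem Ux; apply: differentiable_continuous.
  exact: Drow_differentiable Ux.
- move=> v; split.
    move=> x /set_mem Ux; apply: diff_derivable; exact: Drow_differentiable Ux.
  apply: IH => j; apply: (eq_Dk oU _ (Dk_derive v (DG j))) => x Ux.
  by rewrite derive_row//; apply: diff_derivable; exact: Drow_differentiable Ux.
Qed.

Lemma Drow_smooth V n (U : set V) (G : V -> 'rV[R]_n) : open U ->
  (forall k, Drow k U G) -> smooth U G.
Proof. by move=> oU DG k; exact: Drow_Ck. Qed.

End strong_smoothness.

HB.instance Definition _ (R : realType) n := Complete.on 'rV[R]_n.

(** * The inverse function theorem, by contraction *)

Section inverse_function.
Context {R : realType}.

Lemma rV_coord_le n (u : 'rV[R]_n) j : `|u 0 j| <= `|u|.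
Proof.
rewrite [leRHS]/Num.Def.normr/= mx_normrE.
exact: (le_bigmax _ (fun ij => `|u ij.1 ij.2|) (0, j)).
Qed.

Lemma rV_norm_le n (u : 'rV[R]_n) c : 0 <= c -> (forall j, `|u 0 j| <= c) ->
  `|u| <= c.
Proof.
move=> c0 uc; rewrite [leLHS]/Num.Def.normr/= mx_normrE.
by apply: bigmax_le => // -[i j] _ /=; rewrite (ord1 i).
Qed.

Lemma mulmx_continuous m n (M : 'M[R]_(m, n)) :
  continuous (fun u : 'rV[R]_m => u *m M).
Proof.
move=> u; apply: differentiable_continuous.
exact: (Drow_differentiable (Drow_mulmx 0 M openT)).
Qed.

Lemma mulmx_norm_le m n (M : 'M[R]_(m, n)) :
  exists2 c, 0 < c & forall u : 'rV[R]_m, `|u *m M| <= c * `|u|.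
Proof.
have [|c c0 uc] := @linear_lipschitz _ _ _ (mulmxr M : {linear 'rV[R]_m -> 'rV[R]_n}).
  exact: mulmx_continuous.
by exists c.
Qed.

Lemma derive_sum_delta n (g : 'rV[R]_n -> R) z u : differentiable g z ->
  'D_u g z = \sum_i u 0 i * 'D_(delta_mx 0 i) g z.
Proof.
move=> dg; rewrite deriveE// [u in LHS]row_sum_delta linear_sum.
by apply: eq_bigr => i _; rewrite linearZ/= -deriveE.
Qed.

Lemma ball_segment n (x0 x y : 'rV[R]_n) r (t : R) : ball x0 r x -> ball x0 r y ->
  0 <= t <= 1 -> ball x0 r (t *: (x - y) + y).
Proof.
rewrite -!ball_normE /= => xr yr /andP[t0 t1].
have -> : x0 - (t *: (x - y) + y) = t *: (x0 - x) + (1 - t) *: (x0 - y).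
  by apply/rowP => i; rewrite !mxE; ring.
apply: le_lt_trans (ler_normD _ _) _; rewrite !normrZ !ger0_norm ?subr_ge0//.
(* The strict inequality comes from the term with factor [t], so [t = 0] is treated apart; the other
   term only needs a weak bound. *)
have [->|tn0] := eqVneq t 0; first by rewrite mul0r add0r subr0 mul1r.
have t_gt0 : 0 < t by rewrite lt_neqAle eq_sym tn0.
have -> : r = t * r + (1 - t) * r by ring.
by rewrite ltr_leD ?ltr_pM2l// ler_wpM2l ?subr_ge0// ltW.
Qed.

(** The one-variable mean value theorem along the segment from [y] to [x]. The factor [n] comes from
    expanding the directional derivative into [n] partial derivatives, each coordinate of [x - y]
    being at most the sup norm. *)
Lemma mean_value_bound n (g : 'rV[R]_n -> R) x0 r c : 0 <= c ->
  (forall z, ball x0 r z -> differentiable g z) ->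
  (forall z, ball x0 r z -> forall i, `|'D_(delta_mx 0 i) g z| <= c) ->
  forall x y, ball x0 r x -> ball x0 r y -> `|g x - g y| <= n%:R * c * `|x - y|.
Proof.
move=> c0 dg gc x y xr yr.
pose psi (t : R) := t *: (x - y) + y.
have dpsi t : is_diff t psi ( *:%R^~ (x - y)).
  have -> : psi = ( *:%R^~ (x - y)) + cst y by [].
  by apply: is_diff_eq; rewrite addr0.
have dphi (t : R) : t \in `[0, 1] -> is_derive t 1 (g \o psi) ('D_(x - y) g (psi t)).
  rewrite in_itv/= => /(ball_segment xr yr) br.
  have dgt := dg _ br; have dp : differentiable psi t by [].
  have dc := differentiable_comp dp dgt.
  apply: DeriveDef; first exact: diff_derivable.
  rewrite deriveE// (diff_comp dp dgt) /= [X in 'd g _ X](_ : _ = x - y).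
    by rewrite deriveE.
  by rewrite diff_val scale1r.
pose dp (t : R) : R := 'D_(x - y) g (psi t).
have ci : {within `[0, 1], continuous (g \o psi)}.
  apply: continuous_in_subspaceT => t /set_mem/= t01.
  have dgt : derivable (g \o psi) t 1 by case: (dphi t t01).
  exact/differentiable_continuous/derivable1_diffP.
have di (t : R) : t \in `]0, 1[ -> is_derive t 1 (g \o psi) (dp t).
  by move=> t01; apply: dphi; exact: subset_itv_oo_cc.
have [t t01] := MVT_segment ler01 di ci.
rewrite subr0 mulr1 /= /psi scale1r scale0r subrK add0r => ->.
move: t01; rewrite in_itv/= => /(ball_segment xr yr) br.
rewrite /dp derive_sum_delta; last exact: dg.
apply: le_trans (ler_norm_sum _ _ _) _.
have -> : n%:R * c * `|x - y| = \sum_(i < n) `|x - y| * c.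
  by rewrite sumr_const card_ord -mulr_natl; ring.
apply: ler_sum => i _; rewrite normrM.
by apply: ler_pM => //; [exact: rV_coord_le|exact: gc].
Qed.

Section near_identity.
Variables (n : nat) (F : 'rV[R]_n -> 'rV[R]_n) (B : set 'rV[R]_n).
Hypothesis F_near_id : forall x y, B x -> B y ->
  `|(x - F x) - (y - F y)| <= 2^-1 * `|x - y|.

Lemma near_id_expand x y : B x -> B y -> `|x - y| <= 2 * `|F x - F y|.
Proof.
move=> Bx By; have h := F_near_id Bx By.
have : `|x - y| <= `|(x - F x) - (y - F y)| + `|F x - F y|.
  rewrite -[X in `|X| <= _](_ : (x - F x) - (y - F y) + (F x - F y) = _).
    exact: ler_normD.
  by apply/rowP => i; rewrite !mxE; ring.
by lra.
Qed.

(** Solving [F y = z] amounts to finding a fixed point of [phi], which halves distances because the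
    identity minus [F] does. *)
Lemma near_id_open A : open A -> A `<=` B -> open (F @` A).
Proof.
move=> oA AB; rewrite openE => _ [x Ax <-].
have /nbhs_closedballP[r xrA] : nbhs x A by exact: open_nbhs_nbhs.
have r0 : 0 < r%:num by [].
have cE z : closed_ball x r%:num z <-> `|x - z| <= r%:num.
  by rewrite closed_ballE.
(* Once [F x] is within [r / 2] of [z], the contraction accounts for the other half and [phi] maps
   the closed ball of radius [r] to itself. *)
apply/nbhs_ballP; exists (r%:num / 2) => /=; first by rewrite divr_gt0.
move=> z; rewrite -ball_normE /= => Fxz.
pose phi (y : 'rV[R]_n) := y - F y + z.
have Bx : B x by exact: AB.
have Br y : closed_ball x r%:num y -> B y by move=> /xrA/AB.
have phiF : set_fun (closed_ball x r%:num) (closed_ball x r%:num) phi.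
  move=> y ry; apply/cE.
  have -> : x - phi y = ((x - F x) - (y - F y)) + (F x - z).
    by apply/rowP => i; rewrite !mxE; ring.
  apply: le_trans (ler_normD _ _) _.
  have := F_near_id Bx (Br _ ry); move/cE: ry; lra.
pose phif : {fun closed_ball x r%:num >-> closed_ball x r%:num} := mkfun_fun phiF.
have [|||y ry yE] := @banach_fixed_point R 'rV[R]_n (closed_ball x r%:num) phif.
- exists (2^-1)%:nng; split => /=; first by lra.
  move=> [a b] [/= ra rb]; rewrite /phi.
  have -> : a - F a + z - (b - F b + z) = (a - F a) - (b - F b).
    by apply/rowP => i; rewrite !mxE; ring.
  by apply: F_near_id; exact: Br.
- exact: closed_ball_closed.
- by exists x; apply/cE; rewrite subrr normr0.
exists y; first exact: xrA.
apply/rowP => i; move/rowP: yE => /(_ i); rewrite /= /phi !mxE.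
lra.
Qed.

End near_identity.

(** Vectors are rows multiplied on the right by matrices, hence this layout: the row index is the
    direction, the column index the component. *)
Lemma jacobianE n m (U : set 'rV[R]_n) (H : 'rV[R]_n -> 'rV[R]_m) x i j :
  Drow 0 U H -> U x -> jacobian H x i j = 'D_(delta_mx 0 i) (fun y => H y 0 j) x.
Proof.
move=> DH Ux; have dH := Drow_differentiable DH Ux.
rewrite -derive_row; last exact: diff_derivable.
by rewrite deriveEjacobian// -rowE [RHS]mxE.
Qed.

Lemma Dk_jacobian n m k (U : set 'rV[R]_n) (H : 'rV[R]_n -> 'rV[R]_m) i j :
  open U -> Drow k.+1 U H -> Dk k U (fun x => jacobian H x i j).
Proof.
move=> oU DH; apply: (eq_Dk oU _ (Dk_derive (delta_mx 0 i) (DH j))) => x Ux.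
rewrite (jacobianE (U := U))// => l.
by have [+ _] := DH l; split.
Qed.

Lemma derive_sub_mulmx n (H : 'rV[R]_n -> 'rV[R]_n) (T : 'M[R]_n) x v :
  differentiable H x ->
  'D_v (fun y => y - H y *m T) x = v - v *m jacobian H x *m T.
Proof.
move=> dH; pose mT : {linear 'rV[R]_n -> 'rV[R]_n} := mulmxr T.
have cT : continuous mT by exact: mulmx_continuous.
have dT : differentiable mT (H x) by exact: linear_differentiable.
have dc := differentiable_comp dH dT.
have dvc : 'D_v (mT \o H) x = 'D_v H x *m T.
  rewrite (deriveE v dc).
  rewrite (diff_comp dH dT).
  rewrite /comp.
  have dm := diff_lin (H x) cT.
  rewrite [LHS](congr1 (fun h => h ('d H x v)) dm).
  by rewrite (deriveE v dH).
rewrite (_ : (fun _ => _) = id - (mT \o H))// deriveB ?dvc ?derive_id.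
- by rewrite deriveEjacobian.
- exact: derivable_id.
- exact: diff_derivable.
Qed.

(** Multiplying [H] by the inverse of its Jacobian at [x0] makes the differential there the
    identity. The partial derivatives of the difference [G] with the identity then vanish at [x0],
    stay small nearby, and bound the variation of [G]. *)
Lemma near_id_ball n (U : set 'rV[R]_n) (H : 'rV[R]_n -> 'rV[R]_n) x0 :
  open U -> U x0 -> Drow 1 U H -> jacobian H x0 \in unitmx ->
  exists r : R, [/\ 0 < r, ball x0 r `<=` U,
    forall x, ball x0 r x -> jacobian H x \in unitmx &
    let F x := H x *m invmx (jacobian H x0) in
    forall x y, ball x0 r x -> ball x0 r y ->
      `|(x - F x) - (y - F y)| <= 2^-1 * `|x - y|].
Proof.
move=> oU Ux0 DH uJ; set T := invmx _.
pose G (x : 'rV[R]_n) : 'rV[R]_n := x - H x *m T.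
have DG : Drow 1 U G.
  move=> j; rewrite (_ : (fun _ => _) = (fun x : 'rV[R]_n => x 0 j - (H x *m T) 0 j)).
    apply: DkB => //; first exact: Dk_coord.
    exact: (@Drow_comp _ _ _ _ _ _ setT H (mulmx^~ T) oU _ DH (Drow_mulmx _ _ openT)).
  by apply/funext => x; rewrite !mxE.
pose c (i j : 'I_n) (x : 'rV[R]_n) : R := 'D_(delta_mx 0 i) (fun y => G y 0 j) x.
have c0 i j : c i j x0 = 0.
  have dH0 := Drow_differentiable DH Ux0.
  have dG0 := Drow_differentiable DG Ux0.
  rewrite /c -derive_row; last exact: diff_derivable.
  by rewrite /G derive_sub_mulmx// -mulmxA mulmxV// mulmx1 subrr mxE.
(* Chosen so that [n * e] is at most one half in [mean_value_bound]; [n.+1] keeps the denominator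
   nonzero when [n = 0]. *)
pose e : R := (2 * n.+1%:R)^-1.
have e0 : 0 < e by rewrite invr_gt0 mulr_gt0.
have cnear : \forall x \near x0, forall ij : 'I_n * 'I_n, `|c ij.1 ij.2 x| <= e.
  apply: (@filter_forall 'rV[R]_n ('I_n * 'I_n)%type
    (fun ij => [set x | `|c ij.1 ij.2 x| <= e]) (nbhs x0) _).
  move=> [i j].
  have : {for x0, continuous (c i j)}.
    apply: differentiable_continuous.
    exact: (Dk_differentiable (Dk_derive _ (DG j)) Ux0).
  rewrite /prop_for /continuous_at c0 => /cvgr0Pnorm_le; exact.
have Jnear : \forall x \near x0, jacobian H x \in unitmx.
  have : {for x0, continuous (fun x => \det (jacobian H x))}.
    apply: differentiable_continuous.
    apply: (Dk_differentiable _ Ux0); apply: (@Dk_det _ _ _ 0) => // i j.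
    exact: Dk_jacobian.
  move=> /cvgr_neq0; rewrite unitmxE unitfE in uJ => /(_ uJ).
  by apply: filterS => x; rewrite unitmxE unitfE.
have Unear : nbhs x0 U by exact: open_nbhs_nbhs.
have /nbhs_ballP[r r0 rP] : nbhs x0 (U `&`
    ([set x | forall ij : 'I_n * 'I_n, `|c ij.1 ij.2 x| <= e] `&`
     [set x | jacobian H x \in unitmx])).
  by apply: filterI => //; exact: filterI.
exists r; split; [exact: r0|by move=> x /rP[] |by move=> x /rP[_ []]|].
move=> F x y xr yr; apply: rV_norm_le; first by rewrite mulr_ge0.
move=> j; rewrite -[x - F x]/(G x) -[y - F y]/(G y).
have -> : (G x - G y) 0 j = G x 0 j - G y 0 j by rewrite !mxE.
apply: le_trans (@mean_value_bound n (fun z => G z 0 j) x0 r e (ltW e0) _ _ x y xr yr) _.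
- by move=> z /rP[Uz _]; exact: (Dk_differentiable (DG j) Uz).
- by move=> z /rP[_ [cz _]] i; exact: (cz (i, j)).
rewrite ler_wpM2r// /e invfM mulrCA ger_pMr// ler_pdivrMr ?mul1r ?ler_nat//.
Qed.

Theorem inverse_function n (U : set 'rV[R]_n) (H : 'rV[R]_n -> 'rV[R]_n) x0 :
  open U -> U x0 -> (forall k, Drow k U H) -> jacobian H x0 \in unitmx ->
  exists (O : set 'rV[R]_n) (s : 'rV[R]_n -> 'rV[R]_n),
    [/\ open_nbhs x0 O, O `<=` U, forall x, O x -> s (H x) = x,
        forall A, open A -> A `<=` O -> open (H @` A) &
        forall k, Drow k (H @` O) s].
Proof.
move=> oU Ux0 DH uJ.
have [r [r0 rU rJ]] := near_id_ball oU Ux0 (DH 1) uJ.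
set T := invmx _ => /= Fid.
pose F x := H x *m T.
have uT : T \in unitmx by rewrite unitmx_inv.
pose O := ball x0 r.
have oO : open O by exact: ball_open.
have oH A : open A -> A `<=` O -> open (H @` A).
  move=> oA AO; have oF := near_id_open Fid oA AO.
  (* As [T] is invertible, openness of the image under the normalised map [F] pulls back to the
     image under [H]. *)
  rewrite (_ : H @` A = (mulmx^~ T) @^-1` (F @` A)).
    by apply: open_comp => // z _; exact: mulmx_continuous.
  apply/seteqP; split => [_ [x Ax <-]|z /= [x Ax /(can_inj (mulmxK uT)) <-]].
    by exists x.
  by exists x.
have [C C0 TC] := mulmx_norm_le T.
have expand x y : O x -> O y -> `|x - y| <= 2 * C * `|H x - H y|.
  move=> Ox Oy; apply: le_trans (near_id_expand Fid Ox Oy) _.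
  by rewrite -mulrA ler_pM2l// -mulmxBl.
pose s (z : 'rV[R]_n) : 'rV[R]_n := xget x0 [set x | O x /\ H x = z].
have sP z : (H @` O) z -> O (s z) /\ H (s z) = z.
  by move=> [x Ox Hx]; apply: (@xgetPex _ x0 [set x | O x /\ H x = z]); exists x.
have sH x : O x -> s (H x) = x.
  move=> Ox; have [Os Hs] := sP (H x) (ex_intro2 _ _ x Ox erefl).
  apply/eqP; rewrite -subr_eq0 -normr_le0 (le_trans (expand _ _ Os Ox))//.
  by rewrite Hs subrr normr0 mulr0.
have oHO : open (H @` O) by exact: oH.
pose L z := invmx (jacobian H (s z)).
have sdiff z : (H @` O) z -> is_diff z s (mulmxr (L z)).
  move=> Oz; have [Os Hs] := sP _ Oz.
  apply: is_diff_epsP; first exact: mulmx_continuous.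
  move=> e e0; have [K K0 LK] := mulmx_norm_le (L z).
  have scvg : s @ z --> s z.
    apply/(@cvgrPdist_lt R _ _ (nbhs z) _ s (s z)) => d d0.
    have : nbhs z ((H @` O) `&` ball z (d / (2 * C))).
      apply: filterI; first exact: open_nbhs_nbhs.
      by apply: nbhsx_ballx; rewrite divr_gt0// mulr_gt0.
    rewrite -ball_normE; apply: filterS => z' [Oz' zz']; have [Os' Hs'] := sP _ Oz'.
    apply: le_lt_trans (expand _ _ Os Os') _.
    by rewrite Hs Hs' mulrC -ltr_pdivlMr// mulr_gt0.
  have dH := Drow_differentiable (DH 0) (rU _ Os).
  (* [K] bounds multiplication by [L z] and [2 * C] is the Lipschitz constant of [s]; dividing by
     both leaves exactly [e] at the end. *)
  have e1 : 0 < e / (K * (2 * C)) by rewrite divr_gt0// !mulr_gt0.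
  have := scvg _ (differentiable_epsP dH e1).
  have : \forall z' \near z, (H @` O) z' by exact: open_nbhs_nbhs.
  rewrite nbhs_simpl/=; apply: filterS2 => z' Oz' /=.
  have [Os' Hs'] := sP _ Oz'; rewrite Hs Hs' => Ho.
  (* The first-order remainder of [s] at [z] is minus the remainder of [H] at [s z], multiplied by
     the inverse Jacobian. *)
  have -> : s z' - s z - (z' - z) *m L z =
      - (z' - z - 'd H (s z) (s z' - s z)) *m L z.
    rewrite -deriveE// deriveEjacobian// mulNmx [in RHS]mulmxBl opprB.
    by rewrite {1}/L (mulmxK (rJ _ Os)).
  apply: le_trans (LK _) _; rewrite normrN.
  apply: (@le_trans _ _ (K * (e / (K * (2 * C)) * (2 * C * `|z' - z|)))).
    rewrite ler_pM2l// (le_trans Ho)// ler_pM2l//.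
    by rewrite -[X in _ <= _ * `|X - _|]Hs' -[X in _ <= _ * `|_ - X|]Hs; exact: expand.
  by rewrite le_eqVlt; apply/orP; left; apply/eqP; field; rewrite !gt_eqF.
exists O, s; split => //; first by split => //; exact: ballxx.
elim=> [|k IH] j.
  split => // z Oz; have dz := sdiff z Oz.
  exact: (differentiable_comp (ex_diff : differentiable s z) (differentiable_coord _ _ _)).
split.
  move=> z Oz; have dz := sdiff z Oz.
  exact: (differentiable_comp (ex_diff : differentiable s z) (differentiable_coord _ _ _)).
(* Bootstrapping: the derivatives of [s] are combinations of entries of the inverse Jacobian of [H]
   at [s z], which are of order [k] as soon as [s] is. *)
move=> v; apply: (eq_Dk (g := fun z => \sum_i v 0 i * L z i j)) => //.
  move=> z Oz; have dz := sdiff z Oz.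
  rewrite -derive_row; last exact: diff_derivable.
  by rewrite deriveE// diff_val/= mxE.
apply: Dk_sum => // i; apply: DkZ => //.
apply: (@Dk_invmx _ _ _ _ _ (fun z => jacobian H (s z)) oHO).
  by move=> z /sP[Os _]; exact: rJ.
have sO z : (H @` O) z -> O (s z) by case/sP.
have DJ a b : Dk k O (fun x => jacobian H x a b).
  by apply: Dk_jacobian => // l; apply: subset_Dk (DH _ l).
by move=> a b; exact: (Dk_comp oHO sO IH (DJ a b)).
Qed.

End inverse_function.

(** * Real calculus of complex-valued functions, through real and imaginary parts *)

Section complex_valued.
Context {R : realType}.
Implicit Types (V : normedModType R) (z w : R[i]).
Local Notation Re := (@complex.Re R).
Local Notation Im := (@complex.Im R).

Lemma Re_mulc z w : Re (z * w) = Re z * Re w - Im z * Im w.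
Proof. by case: z => a b; case: w. Qed.

Lemma Im_mulc z w : Im (z * w) = Re z * Im w + Im z * Re w.
Proof. by case: z => a b; case: w. Qed.

Lemma Re_addc z w : Re (z + w) = Re z + Re w.
Proof. by case: z => a b; case: w. Qed.

Lemma Im_addc z w : Im (z + w) = Im z + Im w.
Proof. by case: z => a b; case: w. Qed.

Lemma complex_eqP z w : z = w <-> Re z = Re w /\ Im z = Im w.
Proof. by split=> [->//|]; case: z => a b; case: w => c d /= [-> ->]. Qed.

(** The norm of [R[i]] takes its values in [R[i]]; this is the same modulus as an element of [R],
    where the real calculus applies. *)
Definition modc z : R := Num.sqrt (Re z ^+ 2 + Im z ^+ 2).

Lemma normcR z : `|z| = (modc z)%:C.
Proof. exact: normc_def. Qed.

Lemma modc_eq0 z : (modc z == 0) = (z == 0).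
Proof.
rewrite -(inj_eq (@complexI R)) -normcR.
by rewrite normr_eq0.
Qed.

Lemma sqr_modc z : modc z ^+ 2 = Re z ^+ 2 + Im z ^+ 2.
Proof. by rewrite sqr_sqrtr// addr_ge0// sqr_ge0. Qed.

Lemma Re_div_real z (r : R) : Re (z / r%:C) = Re z / r.
Proof. by rewrite -fmorphV Re_mulc /= mulr0 subr0. Qed.

Lemma Im_div_real z (r : R) : Im (z / r%:C) = Im z / r.
Proof. by rewrite -fmorphV Im_mulc /= mulr0 add0r. Qed.

Definition Dc V k (U : set V) (F : V -> R[i]) :=
  Dk k U (fun x => Re (F x)) /\ Dk k U (fun x => Im (F x)).

Lemma Dc_cst V k (U : set V) z : Dc k U (cst z).
Proof. by split; exact: Dk_cst. Qed.

Lemma DcD V k (U : set V) F G : open U -> Dc k U F -> Dc k U G ->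
  Dc k U (fun x => F x + G x).
Proof.
move=> oU [rF iF] [rG iG]; split.
- by apply: (eq_Dk oU _ (DkD oU rF rG)) => x _; rewrite Re_addc.
- by apply: (eq_Dk oU _ (DkD oU iF iG)) => x _; rewrite Im_addc.
Qed.

Lemma DcM V k (U : set V) F G : open U -> Dc k U F -> Dc k U G ->
  Dc k U (fun x => F x * G x).
Proof.
move=> oU [rF iF] [rG iG]; split.
- apply: (eq_Dk oU _ (DkB oU (DkM oU rF rG) (DkM oU iF iG))) => x _.
  by rewrite Re_mulc.
- apply: (eq_Dk oU _ (DkD oU (DkM oU rF iG) (DkM oU iF rG))) => x _.
  by rewrite Im_mulc.
Qed.

Lemma Dc_sum V k (U : set V) (I : Type) (r : seq I) (F : I -> V -> R[i]) :
  open U -> (forall i, Dc k U (F i)) -> Dc k U (fun x => \sum_(i <- r) F i x).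
Proof.
move=> oU DF; elim: r => [|i r IH].
  rewrite (_ : (fun _ => _) = cst 0); first exact: Dc_cst.
  by apply/funext => x; rewrite big_nil.
rewrite (_ : (fun _ => _) = (fun x => F i x + \sum_(j <- r) F j x)).
  exact: DcD.
by apply/funext => x; rewrite big_cons.
Qed.

Lemma DcX V k (U : set V) F n : open U -> Dc k U F -> Dc k U (fun x => F x ^+ n).
Proof.
move=> oU DF; elim: n => [|n IH].
  exact: Dc_cst.
rewrite (_ : (fun _ => _) = (fun x => F x * F x ^+ n)); first exact: DcM.
by apply/funext => x; rewrite exprS.
Qed.

Lemma Dc_horner V k (U : set V) (P : {poly R[i]}) Y : open U -> Dc k U Y ->
  Dc k U (fun x => P.[Y x]).
Proof.
move=> oU DY; elim/poly_ind: P => [|P c IH].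
  rewrite (_ : (fun _ => _) = cst 0); first exact: Dc_cst.
  by apply/funext => x; rewrite horner0.
rewrite (_ : (fun _ => _) = (fun x => P.[Y x] * Y x + c)).
  by apply: (DcD oU); [exact: DcM|exact: Dc_cst].
by apply/funext => x; rewrite !hornerE.
Qed.

Lemma Dc_eval2 V k (U : set V) (f : {poly {poly R[i]}}) X Y : open U ->
  Dc k U X -> Dc k U Y -> Dc k U (fun x => eval2 f (X x) (Y x)).
Proof.
move=> oU DX DY; elim/poly_ind: f => [|f c IH].
  rewrite (_ : (fun _ => _) = cst 0); first exact: Dc_cst.
  by apply/funext => x; rewrite /eval2 horner0 horner0.
rewrite (_ : (fun _ => _) = (fun x => eval2 f (X x) (Y x) * X x + c.[Y x])).
  by apply: (DcD oU); [exact: DcM|exact: Dc_horner].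
by apply/funext => x; rewrite /eval2 !hornerE.
Qed.

Lemma Dc_evalR4 k (U : set 'rV[R]_4) f : open U -> Dc k U (evalR4 f).
Proof. by move=> oU; apply: Dc_eval2 => //; split; exact: Dk_coord. Qed.

Lemma Dc_near_neq0 V (U : set V) F x : open U -> U x -> Dc 0 U F -> F x != 0 ->
  \forall y \near x, F y != 0.
Proof.
move=> oU Ux [rF iF] F0.
have cc G : Dk 0 U G -> {for x, continuous G}.
  by move=> DG; apply: differentiable_continuous; exact: Dk_differentiable DG Ux.
have : Re (F x) != 0 \/ Im (F x) != 0.
  apply/orP; rewrite -negb_and; apply: contra F0 => /andP[/eqP r0 /eqP i0].
  by apply/eqP/complex_eqP; rewrite r0 i0.
by case=> [/(cvgr_neq0 _ (cc _ rF))|/(cvgr_neq0 _ (cc _ iF))];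
   apply: filterS => y; apply: contra => /eqP ->.
Qed.

(** Order 0, that is differentiability, is all that is asked of the modulus and hence of [Phi].
    Nonvanishing of [F] keeps the square root away from its singular point. *)
Lemma Dk_modc V (U : set V) F : open U -> (forall x, U x -> F x != 0) ->
  Dc 0 U F -> Dk 0 U (fun x => modc (F x)).
Proof.
move=> oU F0 [rF iF]; split => // x Ux.
pose q y := Re (F y) * Re (F y) + Im (F y) * Im (F y).
have dq : differentiable q x.
  exact: (Dk_differentiable (DkD oU (DkM oU rF rF) (DkM oU iF iF)) Ux).
have qE y : q y = Re (F y) ^+ 2 + Im (F y) ^+ 2 by rewrite /q !expr2.
rewrite (_ : (fun _ => _) = Num.sqrt \o q).
  apply: differentiable_comp => //; apply/derivable1_diffP.
  apply: (@ex_derive _ _ _ _ _ _ _ (is_derive1_sqrt _)).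
  rewrite qE -sqr_modc exprn_even_gt0//= modc_eq0; exact: F0.
by apply/funext => y; rewrite /modc /= qE.
Qed.

Lemma Dc_Phi (U : set 'rV[R]_4) f : open U ->
  (forall x, U x -> evalR4 f x != 0) -> Dc 0 U (Phi f).
Proof.
move=> oU F0; have DF := Dc_evalR4 0 f oU; have [rF iF] := DF.
have DN : Dk 0 U (fun x => (modc (evalR4 f x))^-1).
  by apply: DkV => //; [move=> x /F0; rewrite modc_eq0|exact: Dk_modc].
split.
- apply: (eq_Dk oU _ (DkM oU rF DN)) => x _.
  by rewrite /Phi normcR Re_div_real.
- apply: (eq_Dk oU _ (DkM oU iF DN)) => x _.
  by rewrite /Phi normcR Im_div_real.
Qed.

End complex_valued.

(** * From the absence of critical points to a transverse tangent direction *)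

Section milnor_transversality.
Context {R : realType}.
Implicit Types (z w : R[i]) (f : {poly {poly R[i]}}).
Local Notation Re := (@complex.Re R).
Local Notation Im := (@complex.Im R).

Lemma is_derive_trig (a b x v : R) :
  is_derive x v (fun y => a * cos y + b * sin y) (v * (b * cos x - a * sin x)).
Proof.
have d1 : is_derive x 1 (fun y => a * cos y + b * sin y) (b * cos x - a * sin x).
  have h : is_derive x 1 (a *: cos + b *: sin : R -> R)
      (a *: (- sin x) + b *: cos x).
    by apply: is_deriveD; apply: is_deriveZ.
  apply: (is_derive_eq h); rewrite /GRing.scale /=; ring.
have df : differentiable (fun y => a * cos y + b * sin y) x.
  by apply/derivable1_diffP; exact: ex_derive.
apply: DeriveDef; first exact: diff_derivable.
rewrite deriveE// -[v in LHS]mulr1 [LHS]linearZ /= -deriveE//.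
by rewrite derive_val.
Qed.

(** Combinations of [cos] and [sin] are stable under derivation, which is what the induction on all
    pairs [a], [b] uses. *)
Lemma Dk_trig k (a b : R) : Dk k setT (fun x => a * cos x + b * sin x).
Proof.
have df (c d x : R) : differentiable (fun y => c * cos y + d * sin y) x.
  by apply/derivable1_diffP; have [] := is_derive_trig c d x 1.
elim: k a b => [|k IH] a b; split => // v.
rewrite (_ : (fun _ => _) = (fun x => (v * b) * cos x + (- (v * a)) * sin x))//.
by apply/funext => x; have [_ ->] := is_derive_trig a b x v; ring.
Qed.

(** The curve is the rotation of [z] by the angle [s], whose velocity at 0 is [z * 'i]. *)
Lemma circle_tangent z : `|z| = 1 -> tangent_space circle (realify z) (realify (z * 'i)).
Proof.
move=> z1; exists setT, (fun s : R => realify (z * (cos s +i* sin s))).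
have cE (s : R) : realify (z * (cos s +i* sin s)) = \row_(j < 2)
    (if j == 0 then Re z * cos s + (- Im z) * sin s else Im z * cos s + Re z * sin s).
  apply/rowP => j; rewrite !mxE; case: ifP => _.
    rewrite Re_mulc /=; ring.
  rewrite Im_mulc /=. ring.
have compE j : (fun s : R => realify (z * (cos s +i* sin s)) 0 j) = (fun s =>
    (if j == 0 then Re z else Im z) * cos s + (if j == 0 then - Im z else Re z) * sin s).
  by apply/funext => s; rewrite cE mxE; case: ifP.
have DR k : Drow k setT (fun s : R => realify (z * (cos s +i* sin s))).
  by move=> j; rewrite compE; exact: Dk_trig.
split.
- by split => //; exact: openT.
- by apply: Drow_smooth => //; exact: openT.
- move=> _ [s _ <-]; exists (z * (cos s +i* sin s)) => //=.
  by rewrite normrM z1 mul1r normcR /modc /= cos2Dsin2 sqrtr1.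
- by congr realify; rewrite cos0 sin0 -[X in _ * X]/(1 : R[i]) mulr1.
- apply/rowP => j; rewrite derive1E derive_row; last first.
    by apply: diff_derivable; exact: (Drow_differentiable (DR 0)).
  rewrite compE; set a := (if _ then _ else _); set b := (if _ then _ else _).
  have [_ ->] := is_derive_trig a b 0 1.
  rewrite cos0 sin0 mul1r mulr1 mulr0 subr0 /b mxE Re_mulc Im_mulc /=.
  by case: ifP => _; ring.
Qed.

Definition sqnorm n (x : 'rV[R]_n) : R := \sum_i x 0 i ^+ 2.

Lemma Dk_sqnorm n k (U : set 'rV[R]_n) : open U -> Dk k U (@sqnorm n).
Proof.
move=> oU; apply: Dk_sum => // i.
by apply: (eq_Dk oU _ (DkM oU (Dk_coord _ _ _) (Dk_coord _ _ _))) => x _; rewrite expr2.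
Qed.

(** Euler's identity in degree 2; it shows that the radial direction is transverse to the sphere. *)
Lemma derive_sqnorm n (x : 'rV[R]_n) : 'D_x (@sqnorm n) x = 2 * sqnorm x.
Proof.
have d i : is_derive x x (fun y : 'rV[R]_n => y 0 i ^+ 2) (2 * x 0 i ^+ 2).
  have [dl lE] : is_derive x x (fun y : 'rV[R]_n => y 0 i) (x 0 i).
    apply: DeriveDef; first by apply: diff_derivable; exact: differentiable_coord.
    by rewrite -(derive_row (G := id))// derive_id.
  have dX := is_deriveM (DeriveDef dl lE) (DeriveDef dl lE).
  rewrite (_ : (fun _ => _) = (fun y : 'rV[R]_n => y 0 i) * (fun y : 'rV[R]_n => y 0 i));
    last first.
    by apply/funext => y; rewrite expr2.
  by apply: (is_derive_eq dX); rewrite /GRing.scale /=; ring.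
rewrite (_ : @sqnorm n = \sum_i (fun y : 'rV[R]_n => y 0 i ^+ 2)).
  by rewrite derive_val /sqnorm fct_sumE mulr_sumr.
by apply/funext => y; rewrite fct_sumE.
Qed.

Lemma sphere3E eps (x : 'rV[R]_4) : sphere3 eps x <-> sqnorm x = eps ^+ 2.
Proof.
rewrite /sphere3 /= -!add_Re2_Im2 -rmorphD /=.
have -> : sqnorm x = Re (cx x) ^+ 2 + Im (cx x) ^+ 2 + (Re (cy x) ^+ 2 + Im (cy x) ^+ 2).
  rewrite /sqnorm !big_ord_recl big_ord0 addr0 /= !addrA.
  by congr (x _ _ ^+ 2 + x _ _ ^+ 2 + x _ _ ^+ 2 + x _ _ ^+ 2);
     apply/val_inj; rewrite /= inordK.
by split=> [/complexI|->].
Qed.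

(* The imaginary and real parts of [z^* w]: for [z <> 0] the first one vanishes
   exactly when [w] is a real multiple of [z]. *)
Definition crossc z w : R := Re z * Im w - Im z * Re w.
Definition dotc z w : R := Re z * Re w + Im z * Im w.

Lemma open_evalR4_neq0 f : open [set x : 'rV[R]_4 | evalR4 f x != 0].
Proof.
rewrite openE => x /= Fx.
exact: (Dc_near_neq0 openT I (Dc_evalR4 0 f openT) Fx).
Qed.

(** Surjectivity of the differential of [Phi] gives a [w] mapped to the tangent vector
    [Phi f v * 'i], and [w] is the velocity of a curve in the sphere, along which [sqnorm] is
    constant. Writing the cross product as [N * g] with [g v = 0], its derivative along [w] is [N v]
    times that of [g], that is [N v ^+ 2]. *)
Lemma transverse_direction f eps v : Phi_no_critical_point f eps ->
  sphere3 eps v -> evalR4 f v != 0 ->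
  exists w : 'rV[R]_4, 'D_w (fun x => crossc (evalR4 f v) (evalR4 f x)) v != 0 /\
            'D_w (@sqnorm 4) v = 0.
Proof.
move=> nc Sv F0.
pose F := evalR4 f; pose N x := modc (F x).
pose a x := Re (Phi f x); pose b x := Im (Phi f x).
have Phi1 : `|Phi f v| = 1.
  by rewrite /Phi normrM normfV normr_id divff// normr_eq0.
have sub : tangent_space circle (realify (Phi f v)) `<=`
    [set 'D_w (fun x => realify (Phi f x)) v | w in
      tangent_space (sphere3 eps `\` [set x | evalR4 f x = 0]) v].
  apply: contrapT => ns; apply: (nc v); split => //.
  by split => //; exact/eqP.
have [w [I [c [[oI I0] sc cX c0 c1]]] Dw] := sub _ (circle_tangent Phi1).
exists w; split; last first.
  have dc : differentiable c 0.
    (* The curve has a one-dimensional source, where the directional derivative provided by [smooth]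
       already gives differentiability. *)
    apply/derivable1_diffP; have [_ /(_ 1)[dc _]] := sc 1%N.
    exact/dc/mem_set.
  have dsq x : differentiable (@sqnorm 4) x.
    exact: (Dk_differentiable (Dk_sqnorm 0 openT)).
  have dcomp : differentiable (@sqnorm 4 \o c) 0 by exact: differentiable_comp.
  have <- : 'D_1 (@sqnorm 4 \o c) 0 = 'D_w (@sqnorm 4) v.
    rewrite (deriveE _ dcomp) (diff_comp dc (dsq _)) /comp -(deriveE _ dc).
    by rewrite -derive1E c1 c0 -deriveE.
  rewrite (@near_eq_derive _ _ _ _ (cst (eps ^+ 2))) ?derive_cst//.
  have : nbhs (0 : R) I by exact: open_nbhs_nbhs.
  apply: filterS => s Is; apply/sphere3E.
  by have [] : (sphere3 eps `\` [set x | evalR4 f x = 0]) (c s) by apply: cX; exists s.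
have oU := @open_evalR4_neq0 f.
pose U := [set x : 'rV[R]_4 | evalR4 f x != 0].
have [rP iP] : Dc 0 U (Phi f) by exact: Dc_Phi.
have DN : Dk 0 U N by apply: Dk_modc => //; exact: Dc_evalR4.
have da : differentiable a v by exact: (Dk_differentiable rP F0).
have db : differentiable b v by exact: (Dk_differentiable iP F0).
have dN : differentiable N v by exact: (Dk_differentiable DN F0).
have rE j : (fun x => realify (Phi f x) 0 j) = if j == 0 then a else b.
  by apply/funext => x; rewrite mxE; case: ifP.
have dr : differentiable (fun x => realify (Phi f x)) v.
  by apply: differentiable_row => j; rewrite rE; case: ifP.
have Dwj j : 'D_w (fun x => realify (Phi f x) 0 j) v = realify (Phi f v * 'i) 0 j.
  by rewrite -Dw derive_row//; exact: diff_derivable.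
have Dwa : 'D_w a v = - b v.
  by have := Dwj 0; rewrite rE /= mxE /= Re_mulc /= mulr0 mulr1 sub0r.
have Dwb : 'D_w b v = a v.
  by have := Dwj 1; rewrite rE /= mxE /= Im_mulc /= mulr0 mulr1 addr0.
(* Valid at the zeros of [F] as well, where both sides vanish; the factorisation by [N] below is an
   equality of functions on the whole space. *)
have reF x : Re (F x) = N x * a x.
  rewrite /a /Phi normcR Re_div_real -/(F x) -/(N x).
  have [N0|N0] := eqVneq (N x) 0; last by rewrite mulrC divfK.
  by move/eqP: N0; rewrite /N modc_eq0 => /eqP ->; rewrite !mul0r mulr0.
have imF x : Im (F x) = N x * b x.
  rewrite /b /Phi normcR Im_div_real -/(F x) -/(N x).
  have [N0|N0] := eqVneq (N x) 0; last by rewrite mulrC divfK.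
  by move/eqP: N0; rewrite /N modc_eq0 => /eqP ->; rewrite !mul0r mulr0.
have N0 : N v != 0 by rewrite /N modc_eq0.
have ab1 : a v ^+ 2 + b v ^+ 2 = 1.
  have NE : N v ^+ 2 = (N v * a v) ^+ 2 + (N v * b v) ^+ 2.
    by rewrite -reF -imF; exact: sqr_modc.
  by apply: (mulfI (expf_neq0 2 N0)); rewrite mulr1 [RHS]NE; ring.
pose g := Re (F v) *: b - Im (F v) *: a.
have dg : differentiable g v by apply: differentiableB; exact: differentiableZ.
have Dg : 'D_w g v = N v.
  rewrite deriveB; [|exact/diff_derivable/differentiableZ..].
  rewrite !deriveZ; [|exact: diff_derivable..].
  rewrite Dwa Dwb reF imF /GRing.scale /= -[RHS]mulr1 -ab1; ring.
have gv : g v = 0 by rewrite /g !fctE reF imF /GRing.scale /=; ring.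
rewrite (_ : (fun _ => _) = N * g); last first.
  apply/funext => x; rewrite /crossc -/(F v) -/(F x) (imF x) (reF x) /g !fctE.
  by rewrite /GRing.scale /=; ring.
rewrite deriveM; [|exact: diff_derivable..].
by rewrite gv Dg scale0r addr0 mulf_neq0.
Qed.

End milnor_transversality.

(** In the rank normal form, [M] is [L] times [U] stacked over a zero block. Taking [L] times the
    opposite stacking for [N] leaves an antidiagonal block matrix, whose inverse is explicit. *)
Lemma complete_columns (F : fieldType) d (M : 'M[F]_(d + d, d)) :
  \rank M = d -> exists N : 'M[F]_(d + d, d), row_mx N M \in unitmx.
Proof.
move=> rM; pose L := col_ebase M; pose U := row_ebase M.
have uL : L \in unitmx by exact: col_ebase_unit.
have uU : U \in unitmx by exact: row_ebase_unit.
exists (L *m col_mx 0 1%:M).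
have -> : row_mx (L *m col_mx 0 1%:M) M = L *m block_mx 0 U 1%:M 0.
  rewrite -{1}[M]mulmx_ebase rM pid_mx_col -/L -/U -mulmxA mul_col_mx mul1mx mul0mx.
  by rewrite -mul_mx_row block_mxEh.
rewrite unitmx_mul uL /=.
have : block_mx 0 U 1%:M 0 *m block_mx 0 1%:M (invmx U) 0 = 1%:M :> 'M[F]_(d + d).
  rewrite mulmx_block !mul0mx !mulmx0 !mul1mx mulmxV// !addr0 !add0r.
  by rewrite -scalar_mx_block.
by case/mulmx1_unit.
Qed.

(** * Coordinates of the sphere adapted to the fibre *)

Section sphere_coordinates.
Context {R : realType}.

(** The two differentials are independent because their values on [w] and [u] form a triangular
    matrix with nonzero diagonal; they can therefore be completed to an invertible matrix. *)
Lemma prescribed_columns (g1 g2 : 'rV[R]_4 -> R) v u w :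
  differentiable g1 v -> differentiable g2 v ->
  'D_w g1 v != 0 -> 'D_w g2 v = 0 -> 'D_u g2 v != 0 ->
  exists2 A : 'M[R]_4, A \in unitmx & forall i,
    A i (inord 2) = 'D_(delta_mx 0 i) g1 v /\ A i (inord 3) = 'D_(delta_mx 0 i) g2 v.
Proof.
move=> d1 d2 w1 w2 u2.
pose M : 'M[R]_(2 + 2, 2) := \matrix_(i, j)
  if j == 0 then 'D_(delta_mx 0 i) g1 v else 'D_(delta_mx 0 i) g2 v.
have MD x : x *m M = \row_j if j == 0 then 'D_x g1 v else 'D_x g2 v.
  apply/rowP => j; rewrite !mxE; case: ifP => j0.
    by rewrite derive_sum_delta//; apply: eq_bigr => i _; rewrite !mxE j0.
  by rewrite derive_sum_delta//; apply: eq_bigr => i _; rewrite !mxE j0.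
have rM : \rank M = 2%N.
  apply/eqP; rewrite eqn_leq rank_leq_col /=.
  pose B : 'M[R]_(1 + 1) := block_mx ('D_w g1 v)%:M 0 ('D_u g1 v)%:M ('D_u g2 v)%:M.
  have BE : B = (col_mx w u : 'M[R]_(1 + 1, 4)) *m M.
    rewrite mul_col_mx !MD; apply/matrixP => i j; rewrite !mxE.
    case: splitP => i' _; rewrite (ord1 i') !mxE; case: splitP => j' jj'; rewrite (ord1 j') in jj' *.
    - by rewrite !mxE eqxx mulr1n (_ : j == 0)//; apply/eqP/val_inj; rewrite /= jj'.
    - by rewrite !mxE w2 (_ : j == 0 = false)//; apply/eqP => /(congr1 val); rewrite /= jj'.
    - by rewrite !mxE eqxx mulr1n (_ : j == 0)//; apply/eqP/val_inj; rewrite /= jj'.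
    - by rewrite !mxE eqxx mulr1n (_ : j == 0 = false)//; apply/eqP => /(congr1 val); rewrite /= jj'.
  have uB : B \in unitmx.
    by rewrite unitmxE unitfE det_lblock !det_scalar1 mulf_neq0.
  have rB : \rank B = 2%N by exact: mxrank_unit.
  by rewrite -[X in (X <= _)%N]rB BE; exact: mxrankM_maxr.
have [N uN] := complete_columns rM.
exists (row_mx N M) => // i; split.
- transitivity (row_mx N M (i : 'I_(2 + 2)) (rshift 2 (0 : 'I_2))).
    by congr fun_of_matrix; apply/val_inj; rewrite /= inordK.
  by rewrite row_mxEr mxE.
- transitivity (row_mx N M (i : 'I_(2 + 2)) (rshift 2 (1 : 'I_2))).
    by congr fun_of_matrix; apply/val_inj; rewrite /= inordK.
  by rewrite row_mxEr mxE.
Qed.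

(** The map [H] of the ambient space has the cross product and [sqnorm] as its last two coordinates,
    so the sphere becomes the slice where the last one is [eps ^+ 2]. Dropping that coordinate gives
    [theta]; [iota] restores it, and [sigma] is the local inverse of [H] after [iota]. *)
Lemma sphere_coordinates f (eps : R) v (W : set 'rV[R]_4) :
  0 < eps -> Phi_no_critical_point f eps -> sphere3 eps v -> evalR4 f v != 0 ->
  open_nbhs v W ->
  exists (O : set 'rV[R]_4) (theta : 'rV[R]_4 -> 'rV[R]_3) (sigma : 'rV[R]_3 -> 'rV[R]_4),
    [/\ open_nbhs v O, O `<=` W,
        forall k, Drow k setT theta &
        forall x, theta x 0 (inord 2) = crossc (evalR4 f v) (evalR4 f x)] /\
    [/\ forall x, O x -> sphere3 eps x -> sigma (theta x) = x,
        forall A, open A -> A `<=` O -> open (theta @` (A `&` sphere3 eps)) &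
        forall k, Drow k (theta @` (O `&` sphere3 eps)) sigma].
Proof.
move=> eps0 nc Sv F0 [oW Wv].
have [w [w1 w2]] := transverse_direction nc Sv F0.
pose h x := crossc (evalR4 f v) (evalR4 f x).
have Dh k (U : set 'rV[R]_4) : open U -> Dk k U h.
  move=> oU; have [rF iF] := Dc_evalR4 k f oU.
  by apply: (DkB oU); exact: DkZ.
have Ds k (U : set 'rV[R]_4) : open U -> Dk k U (@sqnorm R 4) by exact: Dk_sqnorm.
have dh : differentiable h v by exact: (Dk_differentiable (Dh 0 _ openT)).
have ds : differentiable (@sqnorm R 4) v by exact: (Dk_differentiable (Ds 0 _ openT)).
have v2 : 'D_v (@sqnorm R 4) v != 0.
  move/sphere3E: (Sv) => Sv2.
  by rewrite derive_sqnorm Sv2 mulf_neq0// ?pnatr_eq0// expf_neq0// gt_eqF.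
have [A uA AE] := prescribed_columns dh ds w1 w2 v2.
pose H (x : 'rV[R]_4) : 'rV[R]_4 := \row_(i < 4)
  if i == inord 2 then h x else if i == inord 3 then sqnorm x else (x *m A) 0 i.
have HE i : (fun x => H x 0 i) =
    if i == inord 2 then h else if i == inord 3 then @sqnorm R 4 else (fun x => (x *m A) 0 i).
  by apply/funext => x; rewrite mxE; case: ifP => //; case: ifP.
have DH k (U : set 'rV[R]_4) : open U -> Drow k U H.
  move=> oU i; rewrite HE; case: ifP => _; first exact: Dh.
  case: ifP => _; first exact: Ds.
  exact: Drow_mulmx.
(* The first two columns are those of the linear map [A] itself, the last two are the prescribed
   differentials. *)
have JH : jacobian H v = A.
  apply/matrixP => i j; rewrite (jacobianE _ _ (DH 0 _ openT))// HE.
  case: ifP => [/eqP ->|_]; first by have [-> _] := AE i.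
  case: ifP => [/eqP ->|_]; first by have [_ ->] := AE i.
  have dA : differentiable (fun x : 'rV[R]_4 => x *m A) v.
    exact: (Drow_differentiable (Drow_mulmx 0 A openT)).
  rewrite -derive_row; last exact: diff_derivable.
  have -> : (fun x : 'rV[R]_4 => x *m A) = (mulmxr A : {linear 'rV[R]_4 -> 'rV[R]_4}) by [].
  rewrite deriveE// diff_lin /=; last exact: mulmx_continuous.
  by rewrite -rowE mxE.
have [|O [s [[oO Ov] OW sH oH Dsm]]] := inverse_function oW Wv (fun k => DH k W oW).
  by rewrite JH.
pose theta (x : 'rV[R]_4) : 'rV[R]_3 := \row_(j < 3) H x 0 (inord j).
pose iota (u : 'rV[R]_3) : 'rV[R]_4 :=
  \row_(i < 4) if (i < 3)%N then u 0 (inord i) else eps ^+ 2.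
have Di k (U : set 'rV[R]_3) : open U -> Drow k U iota.
  move=> oU i; rewrite (_ : (fun _ => _) =
      if (i < 3)%N then (fun u : 'rV[R]_3 => u 0 (inord i)) else cst (eps ^+ 2)).
    by case: ifP => _; [exact: Dk_coord|exact: Dk_cst].
  by apply/funext => u; rewrite mxE; case: ifP.
have H3 x : H x 0 (inord 3) = sqnorm x.
  by rewrite mxE eqxx; case: ifP => // /eqP/(congr1 val); rewrite /= !inordK.
have iotaK x : sphere3 eps x -> iota (theta x) = H x.
  move=> /sphere3E Sx; apply/rowP => i; rewrite mxE; case: ifPn => i3.
    by rewrite mxE inordK// inord_val.
  have -> : i = inord 3.
    apply/val_inj; rewrite /= inordK//; apply/eqP; rewrite eqn_leq -ltnS ltn_ord.
    by rewrite leqNgt.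
  by rewrite H3 Sx.
(* Images of pieces of the sphere under [theta] are preimages under the continuous [iota] of images
   under [H], hence open. *)
have imE B : theta @` (B `&` sphere3 eps) = iota @^-1` (H @` B).
  apply/seteqP; split => [_ [x [Bx Sx] <-]|u /= [x Bx Hx]].
    by exists x => //; rewrite iotaK.
  have Sx : sphere3 eps x.
    by apply/sphere3E; rewrite -H3 Hx mxE inordK.
  exists x => //; apply/rowP => j; rewrite mxE Hx mxE.
  have j3 := ltn_ord j; rewrite inordK; last exact: ltn_trans j3 _.
  by rewrite j3 inord_val.
have ci : continuous iota.
  move=> u; apply: differentiable_continuous.
  exact: (Drow_differentiable (Di 0 _ openT)).
have oT B : open B -> B `<=` O -> open (theta @` (B `&` sphere3 eps)).
  by move=> oB BO; rewrite imE; apply: open_comp => //; exact: oH.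
exists O, theta, (s \o iota); split; split => //.
- move=> k j; rewrite (_ : (fun _ => _) = (fun x => H x 0 (inord j))).
    exact: (DH k _ openT).
  by apply/funext => x; rewrite mxE.
- by move=> x; rewrite !mxE inordK// eqxx.
- by move=> x Ox Sx; rewrite /= iotaK// sH.
- move=> k; have oTO := oT O oO (@subset_refl _ _).
  apply: (Drow_comp oTO _ (Di k _ oTO) (Dsm k)).
  by move=> u; rewrite imE.
Qed.

End sphere_coordinates.

(** * The fibre near one of its points as a zero set *)

Section local_fibre.
Context {R : realType}.
Implicit Types (z w : R[i]) (f : {poly {poly R[i]}}).
Local Notation Re := (@complex.Re R).
Local Notation Im := (@complex.Im R).

Lemma crosscZ z (c : R) : crossc z (c%:C * z) = 0.
Proof. by rewrite /crossc Re_mulc Im_mulc /=; ring. Qed.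

Lemma crossc_eq0 z w : z != 0 -> crossc z w = 0 ->
  w = (dotc z w / modc z ^+ 2)%:C * z.
Proof.
move=> z0 zw; have m0 : modc z ^+ 2 != 0 by rewrite expf_neq0 ?modc_eq0.
have zw' : Re z * Im w = Im z * Re w by apply/eqP; rewrite -subr_eq0; exact/eqP.
apply/complex_eqP; rewrite Re_mulc Im_mulc /= !mul0r subr0 addr0.
split; rewrite mulrAC; apply: (mulIf m0); rewrite divfK// sqr_modc /dotc.
  have -> : (Re z * Re w + Im z * Im w) * Re z =
      Re z ^+ 2 * Re w + Im z * (Re z * Im w) by ring.
  by rewrite zw'; ring.
have -> : (Re z * Re w + Im z * Im w) * Im z =
    Re z * (Im z * Re w) + Im z ^+ 2 * Im w by ring.
by rewrite -zw'; ring.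
Qed.

Lemma dir_scale z (c : R) : 0 < c -> (c%:C * z) / `|c%:C * z| = z / `|z|.
Proof.
move=> c0; have cC0 : c%:C != 0 by apply/eqP => -[] /eqP; rewrite gt_eqF.
rewrite normrM [`|c%:C|]ger0_norm; last by rewrite ler0c ltW.
by rewrite -mulf_div divff// mul1r.
Qed.

(** The difference of the [m]-th powers is the difference of the values of [Phi] times [S], and [S]
    does not vanish near [v]; so equal powers mean equal values. Conversely a zero cross product
    makes [f x] a real multiple of [f v], and positivity of [dotc] near [v] makes the factor
    positive. *)
Lemma near_same_fibre f (v : 'rV[R]_4) m : (0 < m)%N -> evalR4 f v != 0 ->
  \forall x \near v, evalR4 f x != 0 /\
    (Phi f x ^+ m = Phi f v ^+ m <-> crossc (evalR4 f v) (evalR4 f x) = 0).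
Proof.
move=> m0 F0; pose F := evalR4 f.
pose U := [set x : 'rV[R]_4 | evalR4 f x != 0].
have oU : open U by exact: open_evalR4_neq0.
have [rF iF] := Dc_evalR4 0 f oU.
have DP : Dc 0 U (Phi f) by exact: Dc_Phi.
have Phi0 x : evalR4 f x != 0 -> Phi f x != 0.
  by move=> Fx; rewrite /Phi mulf_neq0// invr_eq0 normr_eq0.
pose S x := \sum_(i < m) Phi f x ^+ (m.-1 - i) * Phi f v ^+ i.
have DS : Dc 0 U S.
  apply: (Dc_sum _ oU) => i.
  by apply: (DcM oU); [exact: DcX|exact: Dc_cst].
(* At [v] the [m] summands coincide, each being [Phi f v ^+ m.-1]. *)
have Sv : S v != 0.
  rewrite /S (eq_bigr (fun=> Phi f v ^+ m.-1)) => [|i _].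
    by rewrite sumr_const card_ord mulrn_eq0 negb_or -lt0n m0 expf_neq0// Phi0.
  by rewrite -exprD subnK// -ltnS prednK.
have nS : \forall x \near v, S x != 0 by exact: (Dc_near_neq0 oU F0 DS Sv).
have nF : \forall x \near v, F x != 0 by exact: (Dc_near_neq0 oU F0 (conj rF iF)).
have nd : \forall x \near v, 0 < dotc (F v) (F x).
  have Dd : Dk 0 U (fun x => dotc (F v) (F x)).
    by apply: (DkD oU); exact: DkZ.
  have cd : {for v, continuous (fun x => dotc (F v) (F x))}.
    by apply: differentiable_continuous; exact: (Dk_differentiable Dd F0).
  have d0 : 0 < dotc (F v) (F v).
    by rewrite /dotc -!expr2 -sqr_modc exprn_even_gt0//= modc_eq0.
  exact: (cvgr_gt _ cd _ d0).
near=> x.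
have Fx : F x != 0 by near: x.
have Sx : S x != 0 by near: x.
have dx : 0 < dotc (F v) (F x) by near: x.
split => //; split => [/eqP|xv].
  rewrite -subr_eq0 subrXX -/(S x) mulf_eq0 (negPf Sx) orbF subr_eq0 => /eqP PE.
  have -> : evalR4 f x = (modc (F x) / modc (F v))%:C * F v; last exact: crosscZ.
  have nx : `|F x| != 0 by rewrite normr_eq0.
  rewrite rmorphM fmorphV /= -!normcR mulrAC -mulrA.
  by rewrite -[F v / _]/(Phi f v) -PE /Phi mulrC divfK.
congr (_ ^+ m); rewrite /Phi {1 2}(crossc_eq0 F0 xv) dir_scale//.
by rewrite divr_gt0// exprn_even_gt0//= modc_eq0.
Unshelve. all: by end_near. Qed.

End local_fibre.

(** * The cyclic action on the ambient space *)

Section action.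
Context {R : realType}.
Implicit Types (zeta : R[i]) (q : int).

Definition of_C2 (x y : R[i]) : 'rV[R]_4 :=
  \row_(i < 4) nth 0 [:: complex.Re x; complex.Im x; complex.Re y; complex.Im y] i.

Lemma cx_of_C2 x y : cx (of_C2 x y) = x.
Proof. by rewrite /cx !mxE !inordK//=; case: x. Qed.

Lemma cy_of_C2 x y : cy (of_C2 x y) = y.
Proof. by rewrite /cy !mxE !inordK//=; case: y. Qed.

Lemma C2_ext (u v : 'rV[R]_4) : cx u = cx v -> cy u = cy v -> u = v.
Proof.
move=> [u0 u1] [u2 u3]; apply/rowP => i; rewrite -(inord_val i).
by case: i => -[|[|[|[|//]]]].
Qed.

(** The action is defined on the whole ambient space rather than on the sphere as a subtype, so that
    the calculus of [Drow] applies to it. *)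
Definition act zeta q (n : nat) (v : 'rV[R]_4) : 'rV[R]_4 :=
  of_C2 (zeta ^+ n * cx v) ((zeta ^+ n) ^ q * cy v).

Lemma Dk_act zeta q n k (U : set 'rV[R]_4) : open U -> Drow k U (act zeta q n).
Proof.
move=> oU.
have [r1 i1] : Dc k U (fun v => zeta ^+ n * cx v).
  by apply: (DcM oU); [exact: Dc_cst|split; exact: Dk_coord].
have [r2 i2] : Dc k U (fun v => (zeta ^+ n) ^ q * cy v).
  by apply: (DcM oU); [exact: Dc_cst|split; exact: Dk_coord].
by move=> [[|[|[|[|//]]]] i4];
   [apply: eq_Dk r1|apply: eq_Dk i1|apply: eq_Dk r2|apply: eq_Dk i2] => // x _;
   rewrite mxE.
Qed.

Lemma act_continuous zeta q n : continuous (act zeta q n).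
Proof.
move=> v; apply: differentiable_continuous.
exact: (Drow_differentiable (Dk_act zeta q n 0 openT)).
Qed.

Lemma actD zeta q m n v : act zeta q m (act zeta q n v) = act zeta q (m + n) v.
Proof.
by rewrite /act cx_of_C2 cy_of_C2 !mulrA exprD expfzMl.
Qed.

Variables (zeta : R[i]) (q : int) (p : nat).
Hypotheses (prz : p.-primitive_root zeta) (pq : coprimez p q).

Lemma act_dvd n v : (p %| n)%N -> act zeta q n v = v.
Proof.
rewrite (prim_order_dvd prz) => /eqP zn; apply: C2_ext.
  by rewrite cx_of_C2 zn mul1r.
by rewrite cy_of_C2 zn exp1rz mul1r.
Qed.

(** [n * p.-1] is a natural exponent opposite to [n] modulo [p]: the two add up to [n * p]. *)
Lemma act_inv n v : act zeta q (n * p.-1) (act zeta q n v) = v.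
Proof.
rewrite actD act_dvd// -{2}[n]muln1 -mulnDr addn1 prednK ?dvdn_mull//.
exact: prim_order_gt0 prz.
Qed.

Lemma act_invr n v : act zeta q n (act zeta q (n * p.-1) v) = v.
Proof. by rewrite actD addnC -actD act_inv. Qed.

Lemma norm_prim_root : `|zeta| = 1.
Proof.
have p_gt0 := prim_order_gt0 prz.
by apply/eqP; rewrite -(@pexpr_eq1 _ _ p)// -normrX (prim_expr_order prz) normr1.
Qed.

Lemma act_sphere n eps v : sphere3 eps v -> sphere3 eps (act zeta q n v).
Proof.
have z1 : `|zeta ^+ n| = 1 by rewrite normrX norm_prim_root expr1n.
have zq1 : `|(zeta ^+ n) ^ q| = 1.
  by case: (q) => m; rewrite ?normfV normrX z1 expr1n ?invr1.
by rewrite /sphere3 /= cx_of_C2 cy_of_C2 !normrM z1 zq1 !mul1r.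
Qed.

Lemma evalR4_act (f : {poly {poly R[i]}}) k n v : invariant_with zeta q k f ->
  evalR4 f (act zeta q n v) = (zeta ^+ n) ^+ k * evalR4 f v.
Proof.
move=> inv; elim: n => [|n IH].
  by rewrite act_dvd ?dvdn0// expr0 expr1n mul1r.
rewrite -[n.+1]add1n -actD /evalR4 [in LHS]/act cx_of_C2 cy_of_C2 expr1 inv.
by rewrite -/(evalR4 _ _) IH mulrA exprD expr1 exprMn.
Qed.

(** If the first coordinate is nonzero then [zeta ^+ n = 1]. Otherwise the second one is, which
    gives [p %| n * |q|], and coprimality removes the factor [|q|], whatever the sign of [q]. *)
Lemma act_free n v : v != 0 -> act zeta q n v = v -> (p %| n)%N.
Proof.
move=> v0 av.
have ax : zeta ^+ n * cx v = cx v by rewrite -[RHS](congr1 cx av) cx_of_C2.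
have ay : (zeta ^+ n) ^ q * cy v = cy v by rewrite -[RHS](congr1 cy av) cy_of_C2.
have [x0|x0] := eqVneq (cx v) 0; last first.
  by rewrite (prim_order_dvd prz); apply/eqP/(mulIf x0); rewrite ax mul1r.
have [y0|y0] := eqVneq (cy v) 0.
  case/eqP: v0; apply: C2_ext.
    by rewrite x0 /cx !mxE.
  by rewrite y0 /cy !mxE.
have zq : (zeta ^+ n) ^ q = 1 by apply: (mulIf y0); rewrite ay mul1r.
have : zeta ^+ (n * `|q|%N) = 1.
  rewrite exprM; case: (q) zq => m //=.
  by move/eqP; rewrite -[X in X == 1]/((_ ^+ m.+1)^-1) invr_eq1 => /eqP.
move/eqP; rewrite -(prim_order_dvd prz) Gauss_dvdl//.
Qed.

Lemma act_modn n v : act zeta q (n %% p) v = act zeta q n v.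
Proof.
rewrite [in RHS](divn_eq n p) -[in RHS]actD [in RHS]act_dvd//.
exact: dvdn_mull.
Qed.

(** Near [v], points stay within half of [d i] of [v] and their translates within half of [d i] of
    the translate of [v]; a point of [W] whose translate is in [W] would contradict the triangle
    inequality. Reducing exponents modulo [p] leaves finitely many conditions, and [i = 0] is exempt
    since [d] vanishes there. *)
Lemma act_separated v : v != 0 -> exists2 W, open_nbhs v W &
  forall n x, W x -> W (act zeta q n x) -> (p %| n)%N.
Proof.
move=> v0; have p_gt0 := prim_order_gt0 prz.
pose d (i : 'I_p) := `|act zeta q i v - v|.
pose good (i : 'I_p) := [set x : 'rV[R]_4 | (0 < i)%N ->
  `|act zeta q i v - act zeta q i x| < d i / 2 /\ `|v - x| < d i / 2].
have : nbhs v [set x | forall i, good i x].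
  apply: (@filter_forall 'rV[R]_4 'I_p good (nbhs v) _) => i.
  have [i0|] := posnP i; first by apply: nearW => x; rewrite /good /= i0.
  move=> i0; have di : 0 < d i / 2.
    rewrite divr_gt0// normr_gt0 subr_eq0; apply/eqP => /(act_free v0).
    by rewrite gtnNdvd.
  have n1 : \forall x \near v, `|act zeta q i v - act zeta q i x| < d i / 2.
    exact: (cvgr_dist_lt _ _ (@act_continuous zeta q i v) _ di).
  have n2 : \forall x \near v, `|v - x| < d i / 2.
    exact: (cvgr_dist_lt id _ (@cvg_id _ (nbhs v)) _ di).
  by move: n2; apply: filterS2 n1 => x n1 n2 _.
rewrite nbhsE => -[W oW Wg]; exists W => // n x Wx; rewrite -act_modn => Wy.
have np : (n %% p < p)%N by rewrite ltn_mod.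
have [//|n0] := posnP (n %% p); first by move=> /eqP.
have [ix _] := Wg x Wx (Ordinal np) n0; have [_ iy] := Wg _ Wy (Ordinal np) n0.
have := ler_normD (act zeta q (n %% p) v - act zeta q (n %% p) x)
  (- (v - act zeta q (n %% p) x)).
rewrite normrN opprB addrA subrK -[X in X <= _]/(d (Ordinal np)) /=.
by move: ix iy; rewrite /=; lra.
Qed.

End action.

(** * Descent of the coordinates to the lens space *)

Section lens_charts.
Context {R : realType}.
Variables (zeta : R[i]) (q : int) (p : nat) (eps : R).
Hypothesis prz : p.-primitive_root zeta.
Local Notation S := (set_type (@sphere3 R eps)).
Local Notation proj := (@lens_proj R zeta q eps).
Local Notation act := (act zeta q).
Implicit Types v w : S.

Lemma sphere_point (x : 'rV[R]_4) : sphere3 eps x -> exists v, set_val v = x.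
Proof. by move=> Sx; exists (exist _ x (mem_set Sx)). Qed.

Lemma sphere_val v : sphere3 eps (set_val v).
Proof. exact: set_valP. Qed.

Lemma set_val_inj v w : set_val v = set_val w -> v = w.
Proof. exact: val_inj. Qed.

Lemma orbit_ofE v w : orbit_of zeta q v w <-> exists n, set_val w = act n (set_val v).
Proof.
split=> -[n]; last by move=> wv; exists n; rewrite wv cx_of_C2 cy_of_C2.
by move=> [wx wy]; exists n; apply: C2_ext; rewrite ?cx_of_C2 ?cy_of_C2.
Qed.

Lemma lens_projP v w : proj v = proj w <-> exists n, set_val w = act n (set_val v).
Proof.
split=> [/eqmodP /asboolP vw|[n wv]].
  apply/orbit_ofE; rewrite vw; apply/orbit_ofE; exists 0%N.
  by rewrite (act_dvd q prz)// dvdn0.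
apply/eqmodP/asboolP/seteqP; split => u /orbit_ofE[m um]; apply/orbit_ofE.
  exists (m + n * p.-1)%N; rewrite -actD wv (act_inv q prz)//.
by exists (m + n)%N; rewrite -actD -wv.
Qed.

Lemma lens_proj_surj (l : lens zeta q eps) : exists v, proj v = l.
Proof. by exists (lens_repr l); exact: reprK. Qed.

Lemma lens_openP (B : set (lens zeta q eps)) : open B <-> open (proj @^-1` B).
Proof. by []. Qed.

Lemma sphere_open_ambient (B : set S) : open B ->
  exists2 A : set 'rV[R]_4, open A & B = set_val @^-1` A.
Proof. by case=> A oA <-; exists A. Qed.

Lemma sphere_open (A : set 'rV[R]_4) : open A -> open (set_val @^-1` A : set S).
Proof. by move=> oA; exists A. Qed.

(** The saturation of an open set is the union of its preimages under all powers of the action, each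
    of which is open. *)
Lemma lens_proj_open (A : set 'rV[R]_4) : open A ->
  open (proj @` (set_val @^-1` A)).
Proof.
move=> oA; apply/lens_openP.
have -> : proj @^-1` (proj @` (set_val @^-1` A)) =
    set_val @^-1` (\bigcup_n (act n @^-1` A)).
  apply/seteqP; split => [v /= [w Aw /esym/lens_projP[n wv]]|v [n _ /= Av]].
    by exists n => //=; rewrite -wv.
  have [w wE] := sphere_point (act_sphere q prz n (sphere_val v)).
  exists w; first by rewrite /= wE.
  by apply/esym/lens_projP; exists n.
apply: sphere_open; apply: bigcup_open => n _.
by apply: open_comp => // x _; exact: act_continuous.
Qed.

Variables (O : set 'rV[R]_4) (theta : 'rV[R]_4 -> 'rV[R]_3) (sigma : 'rV[R]_3 -> 'rV[R]_4).
Hypothesis oO : open O.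
Hypothesis sepO : forall n x, O x -> O (act n x) -> (p %| n)%N.
Hypothesis Dtheta : forall k, Drow k setT theta.
Hypothesis thetaK : forall x, O x -> sphere3 eps x -> sigma (theta x) = x.
Hypothesis open_theta : forall A, open A -> A `<=` O -> open (theta @` (A `&` sphere3 eps)).
Hypothesis Dsigma : forall k, Drow k (theta @` (O `&` sphere3 eps)) sigma.

Lemma lens_proj_inj v w : O (set_val v) -> O (set_val w) -> proj v = proj w -> v = w.
Proof.
move=> Ov Ow /lens_projP[n wv]; apply: set_val_inj; rewrite wv in Ow *.
by rewrite (act_dvd q prz)//; exact: sepO Ow.
Qed.

Lemma theta_inj v w : O (set_val v) -> O (set_val w) ->
  theta (set_val v) = theta (set_val w) -> v = w.
Proof.
move=> Ov Ow vw; apply: set_val_inj.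
by rewrite -(thetaK Ov (sphere_val v)) vw (thetaK Ow (sphere_val w)).
Qed.

Lemma theta_image (A : set 'rV[R]_4) :
  theta @` (A `&` sphere3 eps) = (theta \o set_val) @` (set_val @^-1` A : set S).
Proof.
apply/seteqP; split => [_ [x [Ax Sx] <-]|_ [v Av <-]].
  by have [v vx] := sphere_point Sx; exists v; rewrite /= vx.
by exists (set_val v) => //; split => //; exact: sphere_val.
Qed.

Lemma theta_continuous : continuous theta.
Proof.
by move=> x; apply: differentiable_continuous; exact: (Drow_differentiable (Dtheta 0)).
Qed.

(** On the chart domain [xget] selects the representative lying in [O], unique because [O] meets
    each orbit at most once; [lens_repr l] only serves off the domain. *)
Definition lens_coords (l : lens zeta q eps) : 'rV[R]_3 :=
  theta (set_val (xget (lens_repr l) [set w : S | O (set_val w) /\ proj w = l])).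

Lemma lens_coordsE v : O (set_val v) -> lens_coords (proj v) = theta (set_val v).
Proof.
move=> Ov; rewrite /lens_coords.
case: xgetP => [w _ [Ow wv]|/(_ v)]; first by rewrite (lens_proj_inj Ow Ov wv).
by case; split.
Qed.

Definition lens_chart : chart R (lens zeta q eps) 3 :=
  Chart (proj @` (set_val @^-1` O)) lens_coords.

Lemma lens_coords_image (B : set (lens zeta q eps)) : B `<=` dom lens_chart ->
  lens_coords @` B = (theta \o set_val) @` ((set_val @^-1` O) `&` (proj @^-1` B)).
Proof.
move=> BO; apply/seteqP; split => [_ [l Bl <-]|_ [v [Ov Bv] <-]].
  have [v Ov vl] := BO _ Bl; rewrite -vl in Bl *.
  by exists v => //; rewrite lens_coordsE.
by exists (proj v) => //; rewrite lens_coordsE.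
Qed.

Lemma lens_chart_is_chart : is_chart lens_chart.
Proof.
split => /=.
- exact: lens_proj_open.
- move=> _ _ /set_mem[v Ov <-] /set_mem[w Ow <-].
  by rewrite !lens_coordsE// => /(theta_inj Ov Ow) ->.
- move=> _ /set_mem[v Ov <-]; rewrite /continuous_at lens_coordsE//.
  move=> B /=; rewrite nbhsE => -[B' [oB' B'v] B'B].
  have oA : open (O `&` theta @^-1` B').
    by apply: openI => //; apply: open_comp => // x _; exact: theta_continuous.
  rewrite nbhs_simpl /= nbhsE; exists (proj @` (set_val @^-1` (O `&` theta @^-1` B'))).
    by split; [exact: lens_proj_open|exists v].
  by move=> _ [w [Ow B'w] <-]; apply: B'B; rewrite lens_coordsE.
- move=> B /lens_openP/sphere_open_ambient[A oA BA] BO.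
  rewrite lens_coords_image// BA -preimage_setI -theta_image.
  by apply: open_theta; [exact: openI|exact: subIsetl].
Qed.

(** A point [v'] above the domain may lie outside [O], but it is [act n] of a point of [O]. Near
    [v'] the coordinates are thus [theta] after the inverse translation [act m], with smooth inverse
    [act n] after [sigma]. *)
Lemma lens_chart_atlas : lens_atlas zeta q eps lens_chart.
Proof.
split=> [|v' /= [w Ow wv']]; first exact: lens_chart_is_chart.
have /lens_projP[n v'w] := wv'.
pose m := (n * p.-1)%N.
have mn x : act m (act n x) = x by exact: act_inv.
have nm x : act n (act m x) = x by exact: act_invr.
pose A := set_val @^-1` (act m @^-1` O) : set S.
have oA : open (act m @^-1` O).
  by apply: open_comp => // x _; exact: act_continuous.
have coordsE y : A y -> lens_coords (proj y) = theta (act m (set_val y)).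
  move=> Ay; have [u uE] := sphere_point (act_sphere q prz m (sphere_val y)).
  have -> : proj y = proj u by apply/lens_projP; exists m.
  by rewrite lens_coordsE uE.
have imA : (fun y => lens_coords (proj y)) @` A = theta @` (O `&` sphere3 eps).
  apply/seteqP; split => [_ [y Ay <-]|_ [x [Ox Sx] <-]].
    exists (act m (set_val y)); last by rewrite coordsE.
    by split => //; exact: (act_sphere q prz m (sphere_val y)).
  have [y yE] := sphere_point (act_sphere q prz n Sx).
  have Ay : A y by rewrite /A /= yE mn.
  by exists y => //; rewrite coordsE// yE mn.
have oim : open (theta @` (O `&` sphere3 eps)) by apply: open_theta.
pose sig u : 'rV[R]_4 := act n (sigma u).
(* [sig] takes values in the ambient space; [s] lifts it to the sphere, with [v'] as default outside
   the image. *)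
pose s u : S := xget v' [set y : S | set_val y = sig u].
have sE u : (theta @` (O `&` sphere3 eps)) u -> set_val (s u) = sig u.
  move=> [x [Ox Sx] xu].
  have [y yE] := sphere_point (act_sphere q prz n Sx).
  apply: (@xgetPex _ v' [set y : S | set_val y = sig u]); exists y => /=.
  by rewrite yE /sig -xu thetaK.
exists A, s; split.
- by split; [exact: sphere_open|rewrite /A /= v'w mn].
- move=> y Ay; exists (act m @^-1` O), (theta \o act m); split => //.
  apply: Drow_smooth => // k.
  exact: (Drow_comp oA _ (Dk_act zeta q m k oA) (Dtheta k)).
- by rewrite imA.
- rewrite imA; apply: Drow_smooth => // k.
  have Dsig : Drow k (theta @` (O `&` sphere3 eps)) sig.
    by apply: (Drow_comp oim _ (Dsigma k) (Dk_act zeta q n k openT)).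
  by move=> j; apply: (eq_Dk oim _ (Dsig j)) => u /sE ->.
- move=> y Ay; apply: set_val_inj; rewrite coordsE// sE.
    rewrite /sig thetaK ?nm//.
    exact: (act_sphere q prz m (sphere_val y)).
  rewrite -imA; exists y => //; exact: coordsE.
Qed.

End lens_charts.

(** * The slice chart at a point of the fibre *)

Theorem proposition3p9 (R : realType) (p : nat) (q : int) (zeta : R[i])
    (f : {poly {poly R[i]}}) (k : nat) (eps0 eps t : R)
    (hp : (1 <= p)%N) (hpq : coprimez p q) (hzeta : p.-primitive_root zeta)
    (hf : admissible f) (hk : (k < p)%N) (hinv : invariant_with zeta q k f)
    (heps0 : milnor_radius f eps0) (heps : 0 < eps <= eps0)
    (ht : 0 <= t < 2 * pi) :
  smooth_submanifold (atlas_on (lens_atlas zeta q eps) (~` link f zeta q eps)) 2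
    (fibre p k f zeta q eps t).
Proof.
have [eps_gt0 _] := andP heps.
have nc := heps0.2 _ heps.
move=> l [nl Psil].
have [v vl] := lens_proj_surj l.
pose x := set_val v.
have Sx : sphere3 eps x by exact: sphere_val.
have Fx : evalR4 f x != 0.
  by apply/eqP => Fx0; apply: nl; exists v.
have m0 : (0 < pbar p k)%N.
  by rewrite divn_gt0 ?gcdn_gt0 ?hp ?orbT// dvdn_leq// dvdn_gcdr.
have x0 : x != 0.
  apply/eqP => x0; move/sphere3E: Sx; rewrite x0 /sqnorm big1 => [/eqP|i _].
    by rewrite eq_sym expf_eq0/= gt_eqF.
  by rewrite mxE expr0n.
have [W1 [oW1 W1x] sepW] := act_separated hzeta hpq x0.
have : nbhs x [set y | evalR4 f y != 0 /\ (Phi f y ^+ pbar p k = Phi f x ^+ pbar p k <->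
    crossc (evalR4 f x) (evalR4 f y) = 0)] by exact: near_same_fibre.
rewrite nbhsE => -[W2 [oW2 W2x] W2P].
have oW : open_nbhs x (W1 `&` W2) by split => //; exact: openI.
have [ O [theta [sigma [H1 H2]]]] :=
  sphere_coordinates eps_gt0 nc Sx Fx oW.
case: H1 H2 => -[oO Ox] OW Dt t2 [tK ot Dsg].
have sepO n y : O y -> O (act zeta q n y) -> (p %| n)%N.
  by move=> /OW[Wy _] /OW[Wny _]; exact: sepW Wny.
have Psix : Phi f x ^+ pbar p k = cos t +i* sin t.
  by rewrite -(PsiE v hzeta hinv) vl.
(* [O] avoids the zeros of [f], and by invariance vanishing of [f] is constant along orbits, so no
   other representative lies on the lifted link. *)
have off_link (w : set_type (sphere3 eps)) : O (set_val w) ->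
    ~ link f zeta q eps (lens_proj zeta q w).
  move=> /OW[_ /W2P[/eqP Fw _]] [u Fu /(lens_projP q hzeta)[n wu]]; apply: Fw.
  by rewrite wu (evalR4_act hzeta n _ hinv) Fu mulr0.
have fibreE (w : set_type (sphere3 eps)) : O (set_val w) ->
    fibre p k f zeta q eps t (lens_proj zeta q w) <-> theta (set_val w) 0 (inord 2) = 0.
  move=> Ow; have [_ /W2P[_ PhiE]] := OW _ Ow; rewrite t2 -PhiE Psix.
  rewrite -(PsiE w hzeta hinv); split; first by case.
  by move=> Pw; split => //; exact: off_link.
have coordsE (w : set_type (sphere3 eps)) := lens_coordsE hzeta theta sepO (v := w).
exists (@lens_chart R zeta q eps O theta); split.
- split; first exact: (lens_chart_atlas hzeta oO sepO Dt tK ot Dsg).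
  by move=> _ [w Ow <-]; exact: off_link.
- by exists v.
(* In three coordinates the only index that is at least 2 is 2 itself, the place of the cross
   product. *)
- have sliceE (u : 'rV[R]_3) : slice 2 u <-> u 0 (inord 2) = 0.
    split=> [|u2 i i2]; first by apply; rewrite inordK.
    rewrite -u2; congr (u 0 _); apply/val_inj; rewrite /= inordK//.
    by apply/eqP; rewrite eqn_leq i2 andbT -ltnS ltn_ord.
  apply/seteqP; split=> [_ [_ [[w Ow <-] Fw] <-]|_ [[_ [w Ow <-] <-] /sliceE sw]].
    split; first by exists (lens_proj zeta q w) => //; exists w.
    by apply/sliceE; rewrite /= coordsE//; exact/fibreE.
  exists (lens_proj zeta q w) => //; split; first by exists w.
  by apply/fibreE => //; rewrite -coordsE.
Qed.
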